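(* Let $S$ be a bilateral weighted shift on a complex Hilbert space $\mathcal{H}$ with orthonormal basis $(e_n)_{n\in\mathbb{Z}}$ and bounded weight sequence $(\omega_n)_{n\in\mathbb{Z}}$ of positive real numbers, i.e. $Se_n=\omega_n e_{n+1}$ for all $n\in\mathbb{Z}$. Assume that $$q(S)=r_1^-(S)=r_2^-(S)=r_3^-(S)=r^-(S)\quad\text{and}\quad r_1^+(S)=r_2^+(S)=r_3^+(S)=r^+(S)=r(S).$$ (a) If $S$ is not invertible, then either $S$ possesses Bishop's property $(\beta)$ or $\sigma_\beta(S)=\{\lambda\in\mathbb{C}:|\lambda|=r(S)\}$. (b) If $S$ is invertible, then either $S$ possesses Bishop's property $(\beta)$, or $\sigma_\beta(S)$ equals one of the circles $\{\lambda\in\mathbb{C}:|\lambda|=\frac{1}{r(S^{-1})}\}$ and $\{\lambda\in\mathbb{C}:|\lambda|=r(S)\}$, or the union of both of them.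
   Context: $r(\cdot)$ is the spectral radius and $q(S)=\min\{|\lambda|:\lambda\in\sigma(S)\}$. Put $\beta_n=\omega_0\cdots\omega_{n-1}$ for $n>0$, $\beta_0=1$, and $\beta_n=\frac{1}{\omega_n\cdots\omega_{-1}}$ for $n<0$. Define $r^-(S)=\lim_{n\to+\infty}\big[\sup_{k>0}\frac{\beta_{-k}}{\beta_{-n-k}}\big]^{1/n}$, $r^+(S)=\lim_{n\to+\infty}\big[\sup_{k\ge0}\frac{\beta_{n+k}}{\beta_k}\big]^{1/n}$, $r_1^-(S)=\lim_{n\to+\infty}\big[\inf_{k>0}\frac{\beta_{-k}}{\beta_{-n-k}}\big]^{1/n}$, $r_1^+(S)=\lim_{n\to+\infty}\big[\inf_{k\ge0}\frac{\beta_{n+k}}{\beta_k}\big]^{1/n}$, $r_2^-(S)=\liminf_{n\to+\infty}[1/\beta_{-n}]^{1/n}$, $r_2^+(S)=\liminf_{n\to+\infty}\beta_n^{1/n}$, $r_3^-(S)=\limsup_{n\to+\infty}[1/\beta_{-n}]^{1/n}$, $r_3^+(S)=\limsup_{n\to+\infty}\beta_n^{1/n}$. For open $U\subset\mathbb{C}$, $\mathcal{O}(U,\mathcal{H})$ is the Fréchet space of analytic $\mathcal{H}$-valued functions on $U$ with the topology of uniform convergence on compact subsets. For a bounded operator $T$ on $\mathcal{H}$, $T_U$ is the map on $\mathcal{O}(U,\mathcal{H})$ given by $T_Uf(\lambda)=(T-\lambda)f(\lambda)$. $T$ possesses Bishop's property $(\beta)$ if for every open $U\subset\mathbb{C}$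 the map $T_U$ is injective with closed range; equivalently, for every open $U$ and every sequence $(f_n)$ in $\mathcal{O}(U,\mathcal{H})$, $T_Uf_n\to0$ implies $f_n\to0$ in $\mathcal{O}(U,\mathcal{H})$. $T$ possesses Bishop's property $(\beta)$ at $\lambda_0\in\mathbb{C}$ if there is an open neighbourhood $V$ of $\lambda_0$ such that for every open $U\subset V$ the map $T_U$ is injective with closed range. $\sigma_\beta(T)$ is the set of $\lambda\in\mathbb{C}$ at which $T$ fails to possess Bishop's property $(\beta)$. *)

(* Defs.v *)
From HB Require Import structures.
From mathcomp Require Import all_boot all_order all_algebra.
From mathcomp Require Import all_classical all_reals all_analysis.
From mathcomp Require Export complex.
From mathcomp Require Import sesquilinear.

Set Implicit Arguments.
Unset Strict Implicit.
Unset Printing Implicit Defensive.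

Import Order.TTheory GRing.Theory Num.Theory.
Import numFieldNormedType.Exports.

Local Open Scope classical_set_scope.
Local Open Scope ring_scope.

Section Shift.
Variables (R : realType) (w : int -> R).

Definition shift_beta (n : int) : R :=
  match n with
  | Posz m => \prod_(i < m) w i%:Z
  | Negz m => (\prod_(i < m.+1) w (- (i.+1)%:Z))^-1
  end.

(* At n = 0 the exponent 1/n is 0 and the value is 1; this does not affect
   the limits. *)
Definition rminus : R :=
  limn (fun n : nat =>
    sup [set shift_beta (- k%:Z) / shift_beta (- n%:Z - k%:Z)
         | k in [set k : nat | (0 < k)%N]] `^ (n%:R^-1)).

Definition rplus : R :=
  limn (fun n : nat =>
    sup (range (fun k : nat => shift_beta (n%:Z + k%:Z) / shift_beta k%:Z))
      `^ (n%:R^-1)).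

Definition r1minus : R :=
  limn (fun n : nat =>
    inf [set shift_beta (- k%:Z) / shift_beta (- n%:Z - k%:Z)
         | k in [set k : nat | (0 < k)%N]] `^ (n%:R^-1)).

Definition r1plus : R :=
  limn (fun n : nat =>
    inf (range (fun k : nat => shift_beta (n%:Z + k%:Z) / shift_beta k%:Z))
      `^ (n%:R^-1)).

Definition r2minus : R :=
  limn_inf (fun n : nat => (shift_beta (- n%:Z))^-1 `^ (n%:R^-1)).

Definition r2plus : R := limn_inf (fun n : nat => shift_beta n%:Z `^ (n%:R^-1)).

Definition r3minus : R :=
  limn_sup (fun n : nat => (shift_beta (- n%:Z))^-1 `^ (n%:R^-1)).

Definition r3plus : R := limn_sup (fun n : nat => shift_beta n%:Z `^ (n%:R^-1)).

End Shift.

Section Operators.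
Variables (R : realType) (H : completeNormedModType R[i]).

(* Real-valued modulus; the norm of R[i] takes its values in R[i]. *)
Definition modulus (z : R[i]) : R := complex.Re `|z|.

Definition circle (r : R) : set R[i] := [set z | modulus z = r].

Definition is_inverse (T A : H -> H) : Prop :=
  [/\ linear A, continuous A, cancel T A & cancel A T].

Definition invertible (T : H -> H) : Prop := exists A, is_inverse T A.

Definition spectrum (T : H -> H) : set R[i] :=
  [set z | ~ invertible (fun x => T x - z *: x)].

Definition spectral_radius (T : H -> H) : R := sup (modulus @` spectrum T).

(* The spectrum of a bounded operator is compact, and nonempty when H is not 0,
   so this infimum is a minimum. *)
Definition spectral_min (T : H -> H) : R := inf (modulus @` spectrum T).

(* An element of O(U,H) is represented by a function on the whole plane that is
   analytic (complex differentiable) at each point of U; two such functions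
   represent the same element when they agree on U. *)
Definition analytic_on (U : set R[i]^o) : set (R[i]^o -> H) :=
  [set f | forall z, U z -> derivable f z 1].

Definition TU (T : H -> H) (f : R[i]^o -> H) : R[i]^o -> H :=
  fun z => T (f z) - (z : R[i]) *: f z.

Definition range_TU (T : H -> H) (U : set R[i]^o) : set (R[i]^o -> H) :=
  [set g | analytic_on U g /\
     exists2 f, analytic_on U f & forall z, U z -> TU T f z = g z].

Definition injective_TU (T : H -> H) (U : set R[i]^o) : Prop :=
  forall f g, analytic_on U f -> analytic_on U g ->
    (forall z, U z -> TU T f z = TU T g z) -> forall z, U z -> f z = g z.

(* closed in O(U,H), for uniform convergence on the compact subsets of U *)
Definition closed_range_TU (T : H -> H) (U : set R[i]^o) : Prop :=
  analytic_on U `&` closure (range_TU T U : set {family compactly_in U, R[i]^o -> H})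
    `<=` range_TU T U.

Definition bishop_beta (T : H -> H) : Prop :=
  forall U : set R[i]^o, open U -> injective_TU T U /\ closed_range_TU T U.

Definition bishop_beta_at (T : H -> H) (z0 : R[i]) : Prop :=
  exists V : set R[i]^o, [/\ open V, V z0 &
    forall U, open U -> U `<=` V -> injective_TU T U /\ closed_range_TU T U].

Definition sigma_beta (T : H -> H) : set R[i] :=
  [set z | ~ bishop_beta_at T z].

(* dot is linear in its first argument and conjugate-linear in the second. *)
Definition induces_norm (dot : {dot H for Num.conj}) : Prop :=
  forall x : H, `|x| ^+ 2 = dot x x.

Definition orthonormal_basis (dot : {dot H for Num.conj}) (e : int -> H) : Prop :=
  (forall m n, dot (e m) (e n) = (m == n)%:R) /\
  closure [set x | exists (s : seq int) (c : int -> R[i]),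
                     x = \sum_(i <- s) c i *: e i] = setT.

End Operators.

(* Main.v *)
Require Import Defs.
From HB Require Import structures.
From mathcomp Require Import all_boot all_order all_algebra.
From mathcomp Require Import all_classical all_reals all_analysis.
From mathcomp Require Import complex sesquilinear.
From mathcomp Require Import ring lra zify.

Set Implicit Arguments.
Unset Strict Implicit.
Unset Printing Implicit Defensive.

Import Order.TTheory GRing.Theory Num.Theory.
Import numFieldNormedType.Exports.

Local Open Scope classical_set_scope.
Local Open Scope ring_scope.
Local Open Scope complex_scope.

(** Write q = spectral_min S and r = spectral_radius S; by hypothesis q is also
    the radius rminus of the backward part of the shift and r the radius r1plus
    of its forward part.

    The heart of the matter is that S - z is bounded below whenever |z| differs
    from q and r. For |z| > r and |z| < q the operator S - z is invertible
    (bounded_below_gt_radius, bounded_below_lt_min). For q < |z| < r it need not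
    be, but for large N the weights of S^N exceed |z|^N by a fixed factor on
    basis vectors of index >= 0 and stay below |z|^N by a fixed factor on those
    of index < -N; splitting a vector at index 0 and using orthogonality gives
    the bound, uniformly on closed annuli inside q < |z| < r
    (shift_bounded_below).

    If S - z is uniformly bounded below on all small annuli around a point z0,
    then S has property (beta) at z0, even when S - z0 is not bounded below
    (bounded_below_around_beta). Indeed, a bound for (S - z) f z on an annulus
    bounds f there, Cauchy's estimate carries the bound over to the hole, and so
    approximate solutions of (S - z) f = g converge, with their derivatives, to
    an exact one (local_solution). Cauchy's estimate is proved for functions that
    are merely differentiable and take values in a normed space, with finite
    midpoint sums around squares in place of contour integrals (goursat,
    cauchy_estimate).

    Hence sigma_beta S lies in the union of the circles of radii q and r. If S is
    not invertible then q = 0, and if moreover r > 0 then 0 is surrounded by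
    annuli of radii between q and r, so that it is not in sigma_beta S and only
    the circle of radius r remains. If S is invertible then q is the inverse of
    the spectral radius of its inverse (spectral_min_inverse).

    Finally the diagonal unitary with entries th ^ n, |th| = 1, intertwines S
    with th S (rotation_operator), so sigma_beta S is invariant under rotations
    (bishop_beta_at_rotate): each circle is contained in it or disjoint from it.
    If it is empty, property (beta) holds globally because local solutions can be
    glued (bishop_betaP). *)

(** * Real-valued norms and epsilon-delta forms *)

Section RealNorm.
Variable R : realType.
Implicit Types z : R[i].

(** The norm of a normed space over R[i] is itself an element of R[i], on which
    the order is partial. Its real part carries the same information and lets
    all estimates take place in R. *)
Definition nm (V : normedModType R[i]) (x : V) : R := complex.Re `|x|.

Lemma ge0_ReE z : 0 <= z -> z = (complex.Re z)%:C.
Proof. by move=> z0; rewrite RRe_real// ger0_real. Qed.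

Lemma modulusE z : `|z| = (modulus z)%:C.
Proof. exact: ge0_ReE. Qed.

Section V.
Variable V : normedModType R[i].
Implicit Types x y : V.

Lemma nmE x : `|x| = (nm x)%:C.
Proof. exact: ge0_ReE. Qed.

Lemma nm_ge0 x : 0 <= nm x.
Proof. by rewrite -ler0c -nmE. Qed.

Lemma nm0 : nm (0 : V) = 0.
Proof. by rewrite /nm normr0. Qed.

Lemma nm0_eq0 x : nm x = 0 -> x = 0.
Proof. by move=> x0; apply/normr0_eq0; rewrite nmE x0. Qed.

Lemma nmN x : nm (- x) = nm x.
Proof. by rewrite /nm normrN. Qed.

Lemma nmD x y : nm (x + y) <= nm x + nm y.
Proof. by rewrite -lecR rmorphD /= -!nmE ler_normD. Qed.

Lemma nmB x y : nm (x - y) <= nm x + nm y.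
Proof. by rewrite -(nmN y) nmD. Qed.

Lemma nmC x y : nm (x - y) = nm (y - x).
Proof. by rewrite -nmN opprB. Qed.

Lemma nmtri x y t : nm (x - t) <= nm (x - y) + nm (y - t).
Proof. by apply: le_trans (nmD _ _); rewrite addrA subrK. Qed.

Lemma nmZ (c : R[i]) x : nm (c *: x) = modulus c * nm x.
Proof. by apply: complexI; rewrite rmorphM /= -!nmE normrZ modulusE. Qed.

End V.

Lemma modulus_ge0 z : 0 <= modulus z.
Proof. by rewrite -ler0c -modulusE. Qed.

Lemma modulus0 : modulus (0 : R[i]) = 0.
Proof. by rewrite /modulus normr0. Qed.

Lemma modulus0_eq0 z : modulus z = 0 -> z = 0.
Proof. by move=> z0; apply/normr0_eq0; rewrite modulusE z0. Qed.

Lemma modulus_gt0 z : (0 < modulus z) = (z != 0).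
Proof. by rewrite -ltcR -modulusE normr_gt0. Qed.

Lemma modulusM z w : modulus (z * w) = modulus z * modulus w.
Proof. by apply: complexI; rewrite rmorphM /= -!modulusE normrM. Qed.

Lemma modulusV z : modulus z^-1 = (modulus z)^-1.
Proof. by apply: complexI; rewrite fmorphV /= -!modulusE normfV. Qed.

Lemma modulusX z n : modulus (z ^+ n) = modulus z ^+ n.
Proof. by apply: complexI; rewrite rmorphXn /= -!modulusE normrX. Qed.

Lemma modulusD z w : modulus (z + w) <= modulus z + modulus w.
Proof. by rewrite -lecR rmorphD /= -!modulusE ler_normD. Qed.

Lemma modulusN z : modulus (- z) = modulus z.
Proof. by rewrite /modulus normrN. Qed.

Lemma modulusB z w : modulus (z - w) = modulus (w - z).
Proof. by rewrite -modulusN opprB. Qed.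

Lemma modulus_real (x : R) : modulus x%:C = `|x|.
Proof. by rewrite /modulus normc_def /= expr0n addr0 sqrtr_sqr. Qed.

Lemma modulus_i : modulus ('i : R[i]) = 1.
Proof. by rewrite /modulus normc_def /= expr0n add0r expr1n sqrtr1. Qed.

Lemma Re_le_modulus z : `|complex.Re z| <= modulus z.
Proof. by rewrite -lecR -modulusE normc_ge_Re. Qed.

Lemma Im_le_modulus z : `|complex.Im z| <= modulus z.
Proof.
have := Re_le_modulus (- ('i * z)); rewrite modulusN modulusM modulus_i mul1r.
by case: z => a b /=; rewrite mul0r mul1r sub0r opprK.
Qed.

Lemma modulus_le_ReIm z : modulus z <= `|complex.Re z| + `|complex.Im z|.
Proof.
rewrite {1}(complexE z); apply: le_trans (modulusD _ _) _.
by rewrite modulusM modulus_i mul1r !modulus_real.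
Qed.

Lemma gt0_complexP (e : R[i]) : 0 < e -> exists2 d : R, 0 < d & e = d%:C.
Proof.
move=> e0; exists (complex.Re e); last exact/ge0_ReE/ltW.
by rewrite -ltcR -ge0_ReE// ltW.
Qed.

Lemma nbhs_nmP (V : normedModType R[i]) (x : V) (P : set V) :
  nbhs x P <-> exists2 d : R, 0 < d & forall y, nm (y - x) < d -> P y.
Proof.
split.
  move=> /nbhs_normP[e /= /gt0_complexP[d d0 ->]] eP; exists d => // y yd.
  by apply: eP => /=; rewrite -normrN opprB nmE ltcR.
move=> [d d0 dP]; apply/nbhs_normP; exists d%:C => /=; first by rewrite ltcR.
by move=> y /=; rewrite -normrN opprB nmE ltcR; exact: dP.
Qed.

Lemma nmoE (z : R[i]) : nm (z : R[i]^o) = modulus z.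
Proof. by []. Qed.

Lemma nbhs_modP (x : R[i]^o) (P : set R[i]^o) :
  nbhs x P <-> exists2 d : R, 0 < d & forall y : R[i], modulus (y - x) < d -> P y.
Proof. exact: nbhs_nmP. Qed.

Lemma continuous_nmP (V W : normedModType R[i]) (f : V -> W) x :
  {for x, continuous f} <->
  forall e : R, 0 < e -> exists2 d, 0 < d &
     forall y, nm (y - x) < d -> nm (f y - f x) < e.
Proof.
split.
  move=> fc e e0; apply/nbhs_nmP.
  by apply: (fc [set y | nm (y - f x) < e]); apply/nbhs_nmP; exists e.
move=> fc P /nbhs_nmP[e e0 eP]; apply/nbhs_nmP.
by have [d d0 dP] := fc e e0; exists d => // y /dP; exact: eP.
Qed.

Lemma cvgn_nmP (V : normedModType R[i]) (u : nat -> V) (l : V) :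
  u @ \oo --> l <-> forall e : R, 0 < e -> exists n0, forall n, (n0 <= n)%N -> nm (u n - l) < e.
Proof.
split.
  move=> ul e e0; have /ul[n0 _ n0P] : nbhs l [set y | nm (y - l) < e].
    by apply/nbhs_nmP; exists e.
  by exists n0 => n; exact: n0P.
move=> ul P /nbhs_nmP[e e0 eP]; have [n0 n0P] := ul e e0.
by exists n0 => // n /= /n0P; exact: eP.
Qed.

Lemma cauchy_nm (V : completeNormedModType R[i]) (u : nat -> V) :
  (forall e : R, 0 < e -> exists n0, forall m n, (n0 <= m)%N -> (n0 <= n)%N ->
     nm (u m - u n) < e) -> exists l : V, u @ \oo --> l.
Proof.
move=> uc; suff : cvgn u by move=> uc'; exists (limn u).
apply/cauchy_cvgP/cauchy_ballP => _ /gt0_complexP[e e0 ->].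
have [n0 n0P] := uc e e0.
pose A := u @` [set n | (n0 <= n)%N].
have uA : (u @ \oo) A by exists n0 => // n nn; exists n.
exists (A, A) => //= -[_ _] /= [[m mn <-] [n nn <-]].
by rewrite -ball_normE /= nmE ltcR; exact: n0P.
Qed.

Lemma linear_nmP (V W : normedModType R[i]) (f : V -> W) : linear f ->
  continuous f <-> exists2 M : R, 0 < M & forall x, nm (f x) <= M * nm x.
Proof.
move=> fl; pose F : {linear V -> W} := HB.pack f (GRing.isLinear.Build _ _ _ _ f fl).
split.
  move=> fc; have /linear_boundedP/pinfty_ex_gt0[_ /gt0_complexP[M M0 ->] MP] :=
    @continuous_linear_bounded _ _ _ 0 F (fc 0).
  by exists M => // x; rewrite -lecR rmorphM /= -!nmE MP.
move=> [M M0 MP] x; apply/continuous_nmP => e e0.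
exists (e / M); first exact: divr_gt0.
move=> y yx; rewrite (_ : f y - f x = f (y - x)); last by rewrite -[f]/(F : _ -> _) linearB.
by apply: le_lt_trans (MP _) _; rewrite mulrC -ltr_pdivlMr.
Qed.

Lemma open_modP (U : set R[i]^o) : open U <->
  forall z, U z -> exists2 d : R, 0 < d & forall y : R[i], modulus (y - z) < d -> U y.
Proof.
rewrite openE; split=> UP z Uz; first exact/nbhs_modP/UP.
exact/nbhs_modP/UP.
Qed.

(** Complex differentiability with the error term written as a multiple of |h|:
    this is the form in which errors over the cells of a subdivision add up. *)
Definition has_deriv (V : normedModType R[i]) (f : R[i] -> V) (z : R[i]) (d : V) :=
  forall e : R, 0 < e -> exists2 dl : R, 0 < dl & forall h, modulus h < dl ->
    nm (f (z + h) - f z - h *: d) <= e * modulus h.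

Lemma derivable_nmP (V : normedModType R[i]) (f : R[i]^o -> V) (z : R[i]^o) :
  derivable f z 1 <-> exists d, has_deriv f z d.
Proof.
split.
  move=> fd; exists ('D_1 f z) => e e0.
  have /fd /nbhs_modP[dl dl0 dlP] : nbhs ('D_1 f z) [set y | nm (y - 'D_1 f z) < e].
    by apply/nbhs_nmP; exists e.
  exists dl => // h hdl; have [->|h0] := eqVneq h 0.
    by rewrite addr0 subrr scale0r subr0 nm0 modulus0 mulr0.
  have := dlP h; rewrite subr0 /= => /(_ hdl h0).
  have -> : f (z + h) - f z - h *: 'D_1 f z =
     h *: (h^-1 *: (f (h *: (1 : R[i]^o) + z) - f z) - 'D_1 f z).
    rewrite scalerBr scalerA mulfV// scale1r.
    by rewrite (_ : h *: (1 : R[i]^o) + z = z + h)// /GRing.scale /= mulr1 addrC.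
  by rewrite nmZ mulrC => /ltW; apply: ler_wpM2r; exact: modulus_ge0.
move=> [d fd]; apply/cvg_ex; exists d => P /nbhs_nmP[e e0 eP].
have [dl dl0 dlP] := fd (e / 2) ltac:(by rewrite divr_gt0).
apply/nbhs_modP; exists dl => // h; rewrite subr0 => /dlP + h0.
have hm : 0 < modulus h by rewrite modulus_gt0.
have -> : f (z + h) - f z - h *: d =
   h *: (h^-1 *: (f (h *: (1 : R[i]^o) + z) - f z) - d).
  rewrite scalerBr scalerA mulfV// scale1r.
  by rewrite (_ : h *: (1 : R[i]^o) + z = z + h)// /GRing.scale /= mulr1 addrC.
rewrite nmZ mulrC ler_pM2r// => he; apply: eP; apply: le_lt_trans he _.
by rewrite ltr_pdivrMr// mulr_natr mulr2n ltrDl.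
Qed.

Lemma has_deriv_cont (V : normedModType R[i]) (f : R[i] -> V) z d : has_deriv f z d ->
  forall e : R, 0 < e -> exists2 dl : R, 0 < dl & forall w, modulus (w - z) < dl ->
    nm (f w - f z) < e.
Proof.
move=> fd e e0; have [dl dl0 dlP] := fd 1 ltr01.
have D0 := nm_ge0 d.
exists (Num.min dl (e / (1 + nm d))).
  by rewrite lt_min dl0 divr_gt0//; lra.
move=> w; rewrite lt_min => /andP[/dlP + w2]; rewrite (addrC z) subrK mul1r => w1.
have -> : f w - f z = (f w - f z - (w - z) *: d) + (w - z) *: d by rewrite subrK.
apply: le_lt_trans (nmD _ _) _; rewrite nmZ.
rewrite ltr_pdivlMr in w2; last lra.
apply: le_lt_trans w2; rewrite mulrDr mulr1; lra.
Qed.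

End RealNorm.

(** * Bisection of squares *)

Section Bisection.
Variable R : realType.

Definition in_square (x y s : R) (u v : R) :=
  [/\ x <= u, u <= x + s, y <= v & v <= y + s].

(** Cousin's lemma for squares. If the conclusion failed, one of the four
    quarters would fail too, and so on; the nested bad squares shrink to a
    point (u, v), around which all small squares are good. *)
Lemma square_bisection (P : R -> R -> R -> Prop) (x0 y0 s0 : R) : 0 < s0 ->
  (forall x y s, 0 < s -> P x y (s / 2) -> P (x + s / 2) y (s / 2) ->
     P x (y + s / 2) (s / 2) -> P (x + s / 2) (y + s / 2) (s / 2) -> P x y s) ->
  (forall u v, in_square x0 y0 s0 u v -> exists2 dl, 0 < dl &
     forall x y s, 0 < s < dl -> in_square x y s u v ->
       in_square x0 y0 s0 x y -> in_square x0 y0 s0 (x + s) (y + s) -> P x y s) ->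
  P x0 y0 s0.
Proof.
move=> s00 Pq Ploc; apply: contrapT => nP.
pose Q (c : R * R * R) :=
  [/\ 0 < c.2, ~ P c.1.1 c.1.2 c.2, in_square x0 y0 s0 c.1.1 c.1.2 &
      in_square x0 y0 s0 (c.1.1 + c.2) (c.1.2 + c.2)].
have step c : exists c', Q c -> [/\ Q c', c'.2 = c.2 / 2,
    c.1.1 <= c'.1.1 /\ c'.1.1 + c'.2 <= c.1.1 + c.2 &
    c.1.2 <= c'.1.2 /\ c'.1.2 + c'.2 <= c.1.2 + c.2].
  case: (pselect (Q c)) => [[] |nQ]; last by exists c.
  case: c => -[x y] s /= s_gt0 nPc [? ? ? ?] [? ? ? ?].
  have s2 : 0 < s / 2 by rewrite divr_gt0.
  have [h|h1] := pselect (P x y (s / 2)); last first.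
    by exists (x, y, s / 2) => _; split => //=; (try split => //=); (try split); lra.
  have [h'|h1] := pselect (P (x + s / 2) y (s / 2)); last first.
    by exists (x + s / 2, y, s / 2) => _; split => //=; (try split => //=); (try split); lra.
  have [h''|h1] := pselect (P x (y + s / 2) (s / 2)); last first.
    by exists (x, y + s / 2, s / 2) => _; split => //=; (try split => //=); (try split); lra.
  have [h'''|h1] := pselect (P (x + s / 2) (y + s / 2) (s / 2)); last first.
    by exists (x + s / 2, y + s / 2, s / 2) => _; split => //=; (try split => //=); (try split); lra.
  by case: nPc; exact: Pq.
have [F FP] := choice step.
pose c k := iter k F (x0, y0, s0).
have Qc k : Q (c k).
  elim: k => [|k IH]; first by split=> //=; split; lra.
  by have [] := FP _ IH.
have sk k : (c k).2 = s0 / 2 ^+ k.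
  elim: k => [|k IH]; first by rewrite expr0 divr1.
  have [_ + _ _] := FP _ (Qc k); rewrite -/(c k.+1) => ->.
  by rewrite IH exprSr invfM mulrA.
have mono j k : (j <= k)%N -> [/\ (c j).1.1 <= (c k).1.1,
    (c k).1.1 + (c k).2 <= (c j).1.1 + (c j).2,
    (c j).1.2 <= (c k).1.2 & (c k).1.2 + (c k).2 <= (c j).1.2 + (c j).2].
  move=> /subnKC <-; elim: (k - j)%N => [|m [IH1 IH2 IH3 IH4]]; first by rewrite addn0.
  have := FP _ (Qc (j + m)%N); rewrite addnS -/(c (j + m).+1) => -[_ _ [h1 h2] [h3 h4]].
  by split; [exact: le_trans h1|exact: le_trans IH2|exact: le_trans h3|exact: le_trans IH4].
have sgt k : 0 < (c k).2 by have [] := Qc k.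
have ub1 j k : (c j).1.1 <= (c k).1.1 + (c k).2.
  have [/mono[h1 h2 _ _]|/ltnW/mono[h1 h2 _ _]] := leqP j k.
    by have := sgt k; lra.
  by have := sgt j; lra.
have ub2 j k : (c j).1.2 <= (c k).1.2 + (c k).2.
  have [/mono[_ _ h1 h2]|/ltnW/mono[_ _ h1 h2]] := leqP j k.
    by have := sgt k; lra.
  by have := sgt j; lra.
pose u := sup (range (fun k => (c k).1.1)); pose v := sup (range (fun k => (c k).1.2)).
have inu k : (c k).1.1 <= u <= (c k).1.1 + (c k).2.
  apply/andP; split.
    by apply: ub_le_sup; [exists ((c 0%N).1.1 + (c 0%N).2) => _ [j _ <-]|exists k].
  by apply: ge_sup; [exists (c 0%N).1.1, 0%N|move=> _ [j _ <-]].
have inv k : (c k).1.2 <= v <= (c k).1.2 + (c k).2.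
  apply/andP; split.
    by apply: ub_le_sup; [exists ((c 0%N).1.2 + (c 0%N).2) => _ [j _ <-]|exists k].
  by apply: ge_sup; [exists (c 0%N).1.2, 0%N|move=> _ [j _ <-]].
have /andP[u1 u2] := inu 0%N; have /andP[v1 v2] := inv 0%N.
have [dl dl0 dlP] := Ploc u v ltac:(by split).
have [k kP] : exists k, s0 / 2 ^+ k < dl.
  have [k /ltW kP] : exists k, s0 / dl < k%:R.
    by exists (Num.bound (s0 / dl)); rewrite archi_boundP// divr_ge0// ltW.
  exists k; rewrite ltr_pdivrMr ?exprn_gt0// mulrC -ltr_pdivrMr//.
  by apply: le_lt_trans kP _; rewrite -natrX ltr_nat ltn_expl.
have [h1 h2 h3 h4] := Qc k; apply: h2; apply: dlP => //.
  by rewrite h1 sk.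
by have /andP[? ?] := inu k; have /andP[? ?] := inv k.
Qed.

End Bisection.

(** * Midpoint sums along segments *)

Section SegmentSums.
Variable R : realType.
Implicit Types (a h z : R[i]) (n : nat).

Definition halfc h : R[i] := (2^-1 : R)%:C * h.

Lemma halfcD h : halfc h + halfc h = h.
Proof. by case: h => x y; apply/eqP; rewrite eq_complex /=; apply/andP; split; apply/eqP; field. Qed.

Lemma modulus_halfc h : modulus (halfc h) = modulus h / 2.
Proof. by rewrite modulusM modulus_real ger0_norm ?invr_ge0// mulrC. Qed.

(** The midpoint Riemann sum, with 2 ^ n equal pieces, of the integral of f along
    the segment from a to a + h. Since it is defined by halving the segment,
    the additivity used in bisection arguments holds exactly at each finite
    level, and no integral, hence no limit, has to be constructed. Midpoints are
    chosen because they make the sum exact on affine functions and compatible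
    with the symmetry z |-> - z. *)
Fixpoint seg_sum (V : normedModType R[i]) (f : R[i] -> V) n a h : V :=
  if n is m.+1 then seg_sum f m a (halfc h) + seg_sum f m (a + halfc h) (halfc h)
  else h *: f (a + halfc h).

Section V.
Variable V : normedModType R[i].
Implicit Types f g : R[i] -> V.

Lemma seg_sumD f g n a h :
  seg_sum (fun z => f z + g z) n a h = seg_sum f n a h + seg_sum g n a h.
Proof.
elim: n a h => [|n IH] a h /=; first by rewrite scalerDr.
by rewrite !IH addrACA.
Qed.

Lemma seg_sumN f n a h :
  seg_sum (fun z => - f z) n a h = - seg_sum f n a h.
Proof.
elim: n a h => [|n IH] a h /=; first by rewrite scalerN.
by rewrite !IH opprD.
Qed.

Lemma seg_sum_scale (k : R[i] -> R[i]) (v : V) n a h :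
  seg_sum (fun z => k z *: v) n a h = seg_sum (k : R[i] -> R[i]^o) n a h *: v.
Proof.
elim: n a h => [|n IH] a h /=; first by rewrite scalerA.
by rewrite !IH scalerDl.
Qed.

Lemma seg_sum_affine p (c d : V) n a h :
  seg_sum (fun z => c + (z - p) *: d) n a h = h *: c + (h * (a + halfc h - p)) *: d.
Proof.
elim: n a h => [|n IH] a h /=; first by rewrite scalerDr scalerA.
rewrite !IH addrACA -(scalerDl c) -(scalerDl d) halfcD; congr (_ + _ *: _).
have := halfcD h; have := halfcD (halfc h).
by move: (halfc (halfc h)) => q; move: (halfc h) => m <- <-; ring.
Qed.

Lemma seg_sum_bound f n a h B :
  (forall t : R, 0 <= t <= 1 -> nm (f (a + t%:C * h)) <= B) ->
  nm (seg_sum f n a h) <= modulus h * B.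
Proof.
elim: n a h => [|n IH] a h /= fB.
  rewrite nmZ ler_wpM2l ?modulus_ge0//; apply: fB.
  by apply/andP; split; lra.
apply: le_trans (nmD _ _) _.
have -> : modulus h * B = modulus (halfc h) * B + modulus (halfc h) * B.
  by rewrite modulus_halfc; field.
apply: lerD; apply: IH => t /andP[t0 t1].
  rewrite /halfc mulrA -rmorphM; apply: fB; apply/andP; split; lra.
rewrite /halfc mulrA -addrA -mulrDl -rmorphM -rmorphD; apply: fB; apply/andP; split; lra.
Qed.

(** The midpoints of a segment and of its image under z |-> - z correspond. *)
Lemma seg_sum_neg f n a h :
  seg_sum f n (- (a + h)) h = seg_sum (fun z => f (- z)) n a h.
Proof.
elim: n a h => [|n IH] a h /=.
  by congr (_ *: f _); rewrite -{1}(halfcD h); ring.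
rewrite addrC; congr (_ + _); rewrite -IH; congr seg_sum; rewrite -{1}(halfcD h); ring.
Qed.

End V.

(** Used for the kernel 1 / z, whose contour sums must stay away from 0. *)
Lemma seg_sum_Im_ge (k : R[i] -> R[i]) n a h c :
  (forall t : R, 0 <= t <= 1 -> modulus h * c <= complex.Im (h * k (a + t%:C * h))) ->
  modulus h * c <= complex.Im (seg_sum (k : R[i] -> R[i]^o) n a h).
Proof.
have ImD (u v : R[i]) : complex.Im (u + v) = complex.Im u + complex.Im v.
  by case: u; case: v.
have Imh (u : R[i]) : complex.Im (halfc u) = complex.Im u / 2.
  by case: u => x y /=; field.
elim: n a h => [|n IH] a h /= fB.
  by apply: fB; apply/andP; split; lra.
have -> : modulus h * c = modulus (halfc h) * c + modulus (halfc h) * c.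
  by rewrite modulus_halfc; field.
rewrite ImD; apply: lerD; apply: IH => t /andP[t0 t1].
  rewrite modulus_halfc /halfc -[_%:C * _ * k _]mulrA (Imh (h * _)) mulrAC ler_pM2r//.
  by rewrite mulrA -rmorphM; apply: fB; apply/andP; split; lra.
rewrite modulus_halfc /halfc -[_%:C * _ * k _]mulrA (Imh (h * _)) mulrAC ler_pM2r//.
by rewrite mulrA -addrA -mulrDl -rmorphM -rmorphD; apply: fB; apply/andP; split; lra.
Qed.

End SegmentSums.

(** * Goursat's lemma *)

Section Goursat.
Variable R : realType.

(** The contour sum around the square with lower left corner x + i y and side s.
    The top and left edges keep the orientation of the bottom and right ones and
    are subtracted, so that the edge shared by two squares cancels literally. *)
Definition square_sum (V : normedModType R[i]) (f : R[i] -> V) n (x y s : R) : V :=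
  seg_sum f n (x +i* y) s%:C + seg_sum f n ((x + s) +i* y) (0 +i* s)
  - seg_sum f n (x +i* (y + s)) s%:C - seg_sum f n (x +i* y) (0 +i* s).

Definition on_boundary (x y s : R) (z : R[i]) :=
  in_square x y s (complex.Re z) (complex.Im z) /\
  [\/ complex.Re z = x, complex.Re z = x + s, complex.Im z = y | complex.Im z = y + s].

Lemma halfc_real (s : R) : halfc s%:C = (s / 2)%:C.
Proof. by rewrite /halfc -rmorphM mulrC. Qed.

Lemma halfc_imag (s : R) : halfc (0 +i* s) = 0 +i* (s / 2).
Proof. by apply/eqP; rewrite eq_complex /=; apply/andP; split; apply/eqP; field. Qed.

Lemma complexDr (x y s : R) : (x +i* y) + s%:C = (x + s) +i* y.
Proof. by apply/eqP; rewrite eq_complex /=; apply/andP; split; apply/eqP; ring. Qed.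

Lemma complexDi (x y s : R) : (x +i* y) + (0 +i* s) = x +i* (y + s).
Proof. by apply/eqP; rewrite eq_complex /=; apply/andP; split; apply/eqP; ring. Qed.

Lemma modulus_imag (s : R) : modulus (0 +i* s) = `|s|.
Proof. by rewrite /modulus normc_def /= expr0n add0r sqrtr_sqr. Qed.

Section V.
Variable V : normedModType R[i].
Implicit Types f g : R[i] -> V.

Lemma square_sumD f g n x y s :
  square_sum (fun z => f z + g z) n x y s = square_sum f n x y s + square_sum g n x y s.
Proof.
rewrite /square_sum !seg_sumD !opprD.
by rewrite (AC (2*2*2*2) ((1*3*5*7)*(2*4*6*8))).
Qed.

Lemma square_sumN f n x y s :
  square_sum (fun z => - f z) n x y s = - square_sum f n x y s.
Proof. by rewrite /square_sum !seg_sumN !opprD. Qed.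

Lemma square_sum_scale (k : R[i] -> R[i]) (v : V) n x y s :
  square_sum (fun z => k z *: v) n x y s = square_sum (k : R[i] -> R[i]^o) n x y s *: v.
Proof. by rewrite /square_sum !seg_sum_scale !scalerDl !scaleNr. Qed.

(** The discrete form of the fact that z |-> c + (z - p) d has a primitive. *)
Lemma square_sum_affine p (c d : V) n x y s :
  square_sum (fun z => c + (z - p) *: d) n x y s = 0.
Proof.
rewrite /square_sum !seg_sum_affine.
rewrite !halfc_real !halfc_imag !complexDr !complexDi !opprD !addrA.
rewrite (ACl ((1*3*5*7)*(2*4*6*8))) /=.
rewrite -!scaleNr -!(scalerDl c) -!(scalerDl d).
set A := (X in X *: c + _); set B := (X in _ + X *: d).
have -> : A = 0 by rewrite /A; ring.
have -> : B = 0.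
  rewrite /B {B}; case: p => u v; apply/eqP; rewrite eq_complex /=.
  by apply/andP; split; apply/eqP; field.
by rewrite !scale0r addr0.
Qed.

Lemma square_sum_bound f n x y s B : 0 < s ->
  (forall z, on_boundary x y s z -> nm (f z) <= B) ->
  nm (square_sum f n x y s) <= 4 * s * B.
Proof.
move=> s0 fB.
have ms : modulus s%:C = s by rewrite modulus_real gtr0_norm.
have mis : modulus (0 +i* s) = s by rewrite modulus_imag gtr0_norm.
have tr (t : R) : 0 <= t <= 1 -> 0 <= t * s <= s.
  by move=> /andP[t0 t1]; have s0' := ltW s0; rewrite mulr_ge0//= ler_piMl.
have ti (t : R) : t%:C * (0 +i* s) = 0 +i* (t * s).
  by apply/eqP; rewrite eq_complex /=; apply/andP; split; apply/eqP; ring.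
have b1 : nm (seg_sum f n (x +i* y) s%:C) <= s * B.
  rewrite -[X in X * B]ms; apply: seg_sum_bound => t /tr/andP[t0 t1].
  rewrite -rmorphM complexDr; apply: fB; split=> /=; last exact: Or43.
  by split; lra.
have b2 : nm (seg_sum f n ((x + s) +i* y) (0 +i* s)) <= s * B.
  rewrite -[X in X * B]mis; apply: seg_sum_bound => t /tr/andP[t0 t1].
  rewrite ti complexDi; apply: fB; split=> /=; last exact: Or42.
  by split; lra.
have b3 : nm (seg_sum f n (x +i* (y + s)) s%:C) <= s * B.
  rewrite -[X in X * B]ms; apply: seg_sum_bound => t /tr/andP[t0 t1].
  rewrite -rmorphM complexDr; apply: fB; split=> /=; last exact: Or44.
  by split; lra.
have b4 : nm (seg_sum f n (x +i* y) (0 +i* s)) <= s * B.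
  rewrite -[X in X * B]mis; apply: seg_sum_bound => t /tr/andP[t0 t1].
  rewrite ti complexDi; apply: fB; split=> /=; last exact: Or41.
  by split; lra.
rewrite /square_sum.
apply: le_trans (nmB _ _) _; apply: le_trans (lerD (nmB _ _) b4) _.
apply: le_trans (lerD (lerD (nmD _ _) b3) (lexx _)) _; lra.
Qed.

(** The four inner edges are run through twice, with opposite signs. *)
Lemma square_sumS f n x y s : square_sum f n.+1 x y s =
  square_sum f n x y (s / 2) + square_sum f n (x + s / 2) y (s / 2) +
  square_sum f n x (y + s / 2) (s / 2) + square_sum f n (x + s / 2) (y + s / 2) (s / 2).
Proof.
rewrite /square_sum /= !halfc_real !halfc_imag !complexDr !complexDi.
have hs (u : R) : u + s / 2 + s / 2 = u + s by field.
rewrite !hs [RHS](AC (4*4*4*4)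
  (((1*5)*(6*14))*(11*15)*(4*12)*((2*8)*(3*9)*(7*13)*(10*16)))) /=.
by rewrite !opprD !subrr !addNr !addr0.
Qed.

(** Contour sums of a differentiable function vanish in the limit, without any
    continuity of the derivative. On a small square of side s around p the
    function is affine up to e |z - p|, so its contour sum is O(e s ^ 2); such
    bounds add up under subdivision, because areas do. *)
Lemma goursat f x0 y0 s0 : 0 < s0 ->
  (forall z, in_square x0 y0 s0 (complex.Re z) (complex.Im z) -> exists d, has_deriv f z d) ->
  forall e : R, 0 < e -> exists n0, forall n, (n0 <= n)%N ->
    nm (square_sum f n x0 y0 s0) <= e * s0 ^+ 2.
Proof.
move=> s00 fd e e0.
apply: (square_bisection (P := fun x y s => exists n0, forall n, (n0 <= n)%N ->
  nm (square_sum f n x y s) <= e * s ^+ 2)) => //.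
  move=> x y s s_gt0 [n1 P1] [n2 P2] [n3 P3] [n4 P4].
  exists (maxn (maxn n1 n2) (maxn n3 n4)).+1 => -[//|n]; rewrite ltnS !geq_max.
  move=> /andP[/andP[/P1 h1 /P2 h2] /andP[/P3 h3 /P4 h4]].
  rewrite square_sumS; apply: le_trans (nmD _ _) _; apply: le_trans (lerD (nmD _ _) h4) _.
  apply: le_trans (lerD (lerD (nmD _ _) h3) (lexx _)) _.
  have -> : e * s ^+ 2 = e * (s / 2) ^+ 2 + e * (s / 2) ^+ 2 + e * (s / 2) ^+ 2 + e * (s / 2) ^+ 2 by field.
  by rewrite !lerD.
move=> u v uv; have [d dP] := fd (u +i* v) uv.
have [dl dl0 dlP] := dP (e / 8) ltac:(by rewrite divr_gt0).
exists (dl / 2); first by rewrite divr_gt0.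
move=> x y s /andP[s_gt0 sdl] [u1 u2 v1 v2] _ _; exists 0%N => n _.
pose p := u +i* v.
(* subtracting the tangent map at p leaves the contour sum unchanged *)
have -> : square_sum f n x y s =
   square_sum (fun z => f z - (f p + (z - p) *: d)) n x y s.
  by rewrite square_sumD square_sumN square_sum_affine subr0.
have -> : e * s ^+ 2 = 4 * s * (e / 8 * (2 * s)) by field.
apply: square_sum_bound => // z [[z1 z2 z3 z4] _].
have zp : modulus (z - p) <= 2 * s.
  apply: le_trans (modulus_le_ReIm _) _.
  case: z z1 z2 z3 z4 => a b /= z1 z2 z3 z4.
  have : `|a - u| <= s by rewrite ler_norml; apply/andP; split; lra.
  have : `|b - v| <= s by rewrite ler_norml; apply/andP; split; lra.
  by lra.
have := dlP (z - p) ltac:(by lra); rewrite (addrC (u +i* v)) subrK opprD addrA.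
by move/le_trans; apply; rewrite ler_wpM2l// divr_ge0// ltW.
Qed.

End V.

End Goursat.

(** * Cauchy's estimate for the derivative *)

Section Cauchy.
Variables (R : realType) (V : normedModType R[i]).
Implicit Types f : R[i] -> V.

Lemma has_derivM (k : R[i] -> R[i]) f z (k' : R[i]) d :
  has_deriv (k : R[i] -> R[i]^o) z k' -> has_deriv f z d ->
  has_deriv (fun w => k w *: f w) z (k z *: d + k' *: f z).
Proof.
move=> kd fd e e0.
pose C := modulus (k z) + 1 + nm (f z) + nm d.
have C0 : 0 < C.
  by have := modulus_ge0 (k z); have := nm_ge0 (f z); have := nm_ge0 d; rewrite /C; lra.
pose eta := Num.min 1 (e / (3 * C)).
have eta0 : 0 < eta by rewrite lt_min ltr01 divr_gt0// mulr_gt0.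
have etaC : eta * C <= e / 3.
  have : eta <= e / (3 * C) by rewrite ge_min lexx orbT.
  move=> /(ler_wpM2r (ltW C0)); rewrite (_ : e / (3 * C) * C = e / 3)//.
  by field; rewrite gt_eqF.
have [d1 d10 d1P] := fd eta eta0.
have [d2 d20 d2P] := kd eta eta0.
have [d3 d30 d3P] := has_deriv_cont kd eta0.
exists (Num.min d1 (Num.min d2 d3)); first by rewrite !lt_min d10 d20.
move=> h; rewrite !lt_min => /and3P[/d1P h1 /d2P h2 h3].
have {}h3 := d3P (z + h) ltac:(by rewrite addrC addKr).
have -> : k (z + h) *: f (z + h) - k z *: f z - h *: (k z *: d + k' *: f z) =
  k (z + h) *: (f (z + h) - f z - h *: d) + (k (z + h) - k z - h * k') *: f z
  + (h * (k (z + h) - k z)) *: d.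
  rewrite !scalerBr !scalerDr !scalerBl !mulrBr !scalerBl !scalerA.
  rewrite [k (z + h) * h]mulrC [h * k']mulrC [k' * h]mulrC !opprD !addrA.
  rewrite [RHS](ACl (1*5*8*6*(2*4)*(3*7))) /=.
  by rewrite !addNr !addr0.
rewrite nmoE in h2; rewrite nmoE in h3.
have m0 := modulus_ge0 h.
have kzh : modulus (k (z + h)) <= modulus (k z) + 1.
  have := modulusD (k (z + h) - k z) (k z); rewrite subrK.
  have : eta <= 1 by rewrite ge_min lexx.
  lra.
have b1 : nm (k (z + h) *: (f (z + h) - f z - h *: d)) <= (modulus (k z) + 1) * (eta * modulus h).
  by rewrite nmZ ler_pM// ?modulus_ge0// nm_ge0.
have b2 : nm ((k (z + h) - k z - h * k') *: f z) <= (eta * modulus h) * nm (f z).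
  by rewrite nmZ ler_wpM2r// nm_ge0.
have b3 : nm ((h * (k (z + h) - k z)) *: d) <= (modulus h * eta) * nm d.
  by rewrite nmZ modulusM ler_wpM2r ?nm_ge0// ler_wpM2l// ltW.
apply: le_trans (nmD _ _) _; apply: le_trans (lerD (nmD _ _) b3) _.
apply: le_trans (lerD (lerD b1 b2) (lexx _)) _.
have -> : (modulus (k z) + 1) * (eta * modulus h) + eta * modulus h * nm (f z) +
  modulus h * eta * nm d = eta * C * modulus h by rewrite /C; ring.
by rewrite ler_wpM2r//; lra.
Qed.

Lemma has_deriv_inv (z : R[i]) : z != 0 ->
  has_deriv ((fun w => w^-1) : R[i] -> R[i]^o) z (- (z^-1 * z^-1)).
Proof.
move=> z0 e e0; have mz : 0 < modulus z by rewrite modulus_gt0.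
exists (Num.min (modulus z / 2) (e * modulus z ^+ 3 / 2)).
  by rewrite lt_min !divr_gt0// mulr_gt0// exprn_gt0.
move=> h; rewrite lt_min => /andP[h1 h2]; rewrite nmoE.
have mzh : modulus z / 2 <= modulus (z + h).
  by have := modulusD (z + h) (- h); rewrite modulusN addrK; lra.
have zh0 : z + h != 0 by rewrite -modulus_gt0; apply: lt_le_trans mzh; rewrite divr_gt0.
have -> : (z + h)^-1 - z^-1 - h *: (- (z^-1 * z^-1)) = h * (h / (z * z * (z + h))).
  by rewrite /GRing.scale /=; field; rewrite z0 zh0.
rewrite modulusM mulrC ler_wpM2r ?modulus_ge0// modulusM modulusV !modulusM.
rewrite ler_pdivrMr; last by rewrite !mulr_gt0// modulus_gt0.
apply: le_trans (ltW h2) _.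
have -> : e * modulus z ^+ 3 / 2 = e * (modulus z * modulus z * (modulus z / 2)) by ring.
by rewrite ler_pM2l// ler_pM2l// mulr_gt0.
Qed.

Definition csum f n (s : R) := square_sum f n (- s) (- s) (2 * s).

(** Contour sums around two concentric squares agree in the limit when f is
    differentiable between them. Halving the square twice gives 16 cells: the 4
    that touch 0 form the inner square, and Goursat's lemma applies to the 12
    others. One level is lost because the inner square is halved only once. *)
Lemma csum_halve f (r s e : R) : 0 < s <= r -> 0 < e ->
  (forall z, z != 0 -> `|complex.Re z| <= r -> `|complex.Im z| <= r ->
     exists d, has_deriv f z d) ->
  exists n0, forall n, (n0 <= n)%N -> nm (csum f n.+1 s - csum f n (s / 2)) <= e.
Proof.
move=> /andP[s0 sr] e0 fd; pose t := s / 2.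
have st : s = 2 * t by rewrite /t; field.
have t0 : 0 < t by rewrite divr_gt0.
pose T n x y := square_sum f n x y t.
have good x y : - s <= x <= s - t -> - s <= y <= s - t ->
    [\/ 0 < x, x + t < 0, 0 < y | y + t < 0] ->
    exists n0, forall n, (n0 <= n)%N -> nm (T n x y) <= e / 12.
  move=> /andP[x1 x2] /andP[y1 y2] xy.
  have [] := @goursat _ V f x y t t0 _ (e / (12 * t ^+ 2)).
  - move=> z [z1 z2 z3 z4]; apply: fd.
    + by apply: contraPneq xy => z0; move: z1 z2 z3 z4; rewrite z0 /= => *; case; lra.
    + by rewrite ler_norml; apply/andP; split; lra.
    + by rewrite ler_norml; apply/andP; split; lra.
  - by rewrite divr_gt0// mulr_gt0// exprn_gt0.
  move=> n0 n0P; exists n0 => n /n0P; rewrite (_ : e / (12 * t ^+ 2) * t ^+ 2 = e / 12)//.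
  by field; rewrite gt_eqF.
have [n1 P1] := good (- s) (- s) ltac:(lra) ltac:(lra) ltac:(apply: Or42; lra).
have [n2 P2] := good (- s + t) (- s) ltac:(lra) ltac:(lra) ltac:(apply: Or44; lra).
have [n3 P3] := good (- s) (- s + t) ltac:(lra) ltac:(lra) ltac:(apply: Or42; lra).
have [n4 P4] := good 0 (- s) ltac:(lra) ltac:(lra) ltac:(apply: Or44; lra).
have [n5 P5] := good t (- s) ltac:(lra) ltac:(lra) ltac:(apply: Or41; lra).
have [n6 P6] := good t (- s + t) ltac:(lra) ltac:(lra) ltac:(apply: Or41; lra).
have [n7 P7] := good (- s) 0 ltac:(lra) ltac:(lra) ltac:(apply: Or42; lra).
have [n8 P8] := good (- s) t ltac:(lra) ltac:(lra) ltac:(apply: Or42; lra).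
have [n9 P9] := good (- s + t) t ltac:(lra) ltac:(lra) ltac:(apply: Or43; lra).
have [na Pa] := good t 0 ltac:(lra) ltac:(lra) ltac:(apply: Or41; lra).
have [nb Pb] := good 0 t ltac:(lra) ltac:(lra) ltac:(apply: Or43; lra).
have [nc Pc] := good t t ltac:(lra) ltac:(lra) ltac:(apply: Or43; lra).
exists (\max_(i <- [:: n1; n2; n3; n4; n5; n6; n7; n8; n9; na; nb; nc]) i).+1.
case=> // n; rewrite ltnS !big_cons big_nil !geq_max.
move=> /and5P[/P1 ? /P2 ? /P3 ? /P4 ?] /and5P[/P5 ? /P6 ? /P7 ? /P8 ?].
move=> /and5P[/P9 ? /Pa ? /Pb ? /Pc ? _].
have split2 x y : square_sum f n.+1 x y s = T n x y + T n (x + t) y + T n x (y + t) + T n (x + t) (y + t).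
  exact: square_sumS.
have e1 : csum f n.+2 s = square_sum f n.+1 (- s) (- s) s + square_sum f n.+1 0 (- s) s
    + square_sum f n.+1 (- s) 0 s + square_sum f n.+1 0 0 s.
  rewrite /csum square_sumS; have -> : 2 * s / 2 = s by field.
  by rewrite addNr.
have e2 : csum f n.+1 (s / 2) = T n (- s + t) (- s + t) + T n 0 (- s + t) + T n (- s + t) 0 + T n 0 0.
  rewrite /csum -/t -st; have -> : - t = - s + t by rewrite st; ring.
  by rewrite split2; have -> : - s + t + t = 0 by rewrite st; ring.
rewrite e1 e2 !split2 !add0r; clearbody T; rewrite !opprD.
rewrite (AC (4*4*4*4*4) ((1*2*3*5*6*8)*(9*11*12*14*15*16)*((4*17)*(7*18)*(10*19)*(13*20)))) /=.
rewrite !subrr !addr0.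
have tr u v a b : nm u <= a -> nm v <= b -> nm (u + v : V) <= a + b.
  by move=> ua vb; apply: le_trans (nmD _ _) _; exact: lerD.
have -> : e = e / 12 + e / 12 + e / 12 + e / 12 + e / 12 + e / 12 +
  (e / 12 + e / 12 + e / 12 + e / 12 + e / 12 + e / 12) by field.
by rewrite !tr.
Qed.

Lemma csum_shrink f (r e : R) k : 0 < r -> 0 < e ->
  (forall z, z != 0 -> `|complex.Re z| <= r -> `|complex.Im z| <= r ->
     exists d, has_deriv f z d) ->
  exists n0, forall n, (n0 <= n)%N -> nm (csum f (n + k)%N r - csum f n (r / 2 ^+ k)) <= e.
Proof.
move=> r0 e0 fd; elim: k e e0 => [|k IH] e e0.
  by exists 0%N => n _; rewrite addn0 expr0 divr1 subrr nm0 ltW.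
have [n1 P1] := IH (e / 2) ltac:(by rewrite divr_gt0).
have p2 : 0 < 2 ^+ k :> R by rewrite exprn_gt0.
have [] := @csum_halve f r (r / 2 ^+ k) (e / 2) _ _ fd.
- rewrite divr_gt0//= ler_pdivrMr// ler_peMr ?(ltW r0)//.
  by rewrite exprn_ege1// ler1n.
- by rewrite divr_gt0.
move=> n2 P2; exists (maxn n1 n2) => n; rewrite geq_max => /andP[h1 h2].
rewrite addnS -addSn; apply: le_trans (nmtri _ (csum f n.+1 (r / 2 ^+ k)) _) _.
have -> : e = e / 2 + e / 2 by field.
apply: lerD; first by apply: P1; exact: leq_trans h1 _.
by rewrite exprSr invfM mulrA; exact: P2.
Qed.

Lemma csum_bound f n s B : 0 < s ->
  (forall z, on_boundary (- s) (- s) (2 * s) z -> nm (f z) <= B) ->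
  nm (csum f n s) <= 8 * s * B.
Proof.
move=> s0 fB; apply: le_trans (square_sum_bound _ _ fB) _; first by rewrite mulr_gt0.
by rewrite mulrA [4 * 2](_ : _ = 8)//; ring.
Qed.

End Cauchy.

Section Kernels.
Variable R : realType.

(** For an even kernel such as 1 / z ^ 2, opposite sides of the contour cancel. *)
Lemma csum_even (k : R[i] -> R[i]^o) n (s : R) : (forall z, k (- z) = k z) -> csum k n s = 0.
Proof.
move=> kN; rewrite /csum /square_sum.
have e1 : (- s +i* (- s + 2 * s)) = - ((- s +i* - s) + (2 * s)%:C) :> R[i].
  by apply/eqP; rewrite eq_complex /=; apply/andP; split; apply/eqP; ring.
have e2 : (- s +i* - s) = - (((- s + 2 * s) +i* - s) + (0 +i* (2 * s))) :> R[i].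
  by apply/eqP; rewrite eq_complex /=; apply/andP; split; apply/eqP; ring.
rewrite e1 [X in _ - seg_sum _ _ X (0 +i* _)]e2 !seg_sum_neg.
by rewrite (funext kN) (ACl (1*3*(2*4))) /= !subrr addr0.
Qed.

(** For 1 / z, opposite sides contribute equally; on the bottom and right sides
    the imaginary part of dz / z is s / (s ^ 2 + t ^ 2) dt with |t| <= s, so each
    of the four sides contributes at least 1. *)
Lemma csum_inv n (s : R) : 0 < s -> 4 <= complex.Im (csum ((fun z => z^-1) : R[i] -> R[i]^o) n s).
Proof.
move=> s0; rewrite /csum /square_sum.
have e1 : (- s +i* (- s + 2 * s)) = - ((- s +i* - s) + (2 * s)%:C) :> R[i].
  by apply/eqP; rewrite eq_complex /=; apply/andP; split; apply/eqP; ring.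
have e2 : (- s +i* - s) = - (((- s + 2 * s) +i* - s) + (0 +i* (2 * s))) :> R[i].
  by apply/eqP; rewrite eq_complex /=; apply/andP; split; apply/eqP; ring.
rewrite e1 [X in _ - seg_sum _ _ X (0 +i* _)]e2 !seg_sum_neg.
under [X in _ - seg_sum X _ _ _ - _]eq_fun do rewrite invrN.
under [X in _ - seg_sum X _ _ _]eq_fun do rewrite invrN.
rewrite !seg_sumN !opprK.
have ImD (u v : R[i]) : complex.Im (u + v) = complex.Im u + complex.Im v.
  by case: u; case: v.
have s20 : 0 < 2 * s by rewrite mulr_gt0.
have ts (t : R) : 0 <= t <= 1 -> (- s + t * (2 * s)) ^+ 2 <= s ^+ 2.
  move=> /andP[t0 t1]; rewrite -subr_ge0.
  have -> : s ^+ 2 - (- s + t * (2 * s)) ^+ 2 = 4 * s ^+ 2 * (t * (1 - t)) by ring.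
  by apply: mulr_ge0; [rewrite mulr_ge0 ?sqr_ge0|rewrite mulr_ge0 ?subr_ge0].
have key (x : R) : x ^+ 2 <= s ^+ 2 -> 1 <= 2 * s * s / (s ^+ 2 + x ^+ 2).
  move=> xs; rewrite ler_pdivlMr; last by rewrite ltr_wpDr ?sqr_ge0// exprn_gt0.
  by rewrite mul1r; lra.
have b1 : 1 <= complex.Im (seg_sum ((fun z => z^-1) : R[i] -> R[i]^o) n (- s +i* - s) (2 * s)%:C).
  have := @seg_sum_Im_ge R (fun z => z^-1) n (- s +i* - s) (2 * s)%:C (2 * s)^-1.
  rewrite modulus_real gtr0_norm// mulfV ?gt_eqF//; apply=> t t01.
  have := key _ (ts t t01); congr (_ <= _).
  rewrite -rmorphM complexDr /= sqrrN [s ^+ 2 + _]addrC; ring.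
have b2 : 1 <= complex.Im (seg_sum ((fun z => z^-1) : R[i] -> R[i]^o) n ((- s + 2 * s) +i* - s) (0 +i* (2 * s))).
  have := @seg_sum_Im_ge R (fun z => z^-1) n ((- s + 2 * s) +i* - s) (0 +i* (2 * s)) (2 * s)^-1.
  rewrite modulus_imag gtr0_norm// mulfV ?gt_eqF//; apply=> t t01.
  have := key _ (ts t t01); congr (_ <= _).
  have -> : t%:C * (0 +i* (2 * s)) = 0 +i* (t * (2 * s)).
    by apply/eqP; rewrite eq_complex /=; apply/andP; split; apply/eqP; ring.
  have -> : - s + 2 * s = s by ring.
  rewrite complexDi /=; ring.
by rewrite !ImD; lra.
Qed.

End Kernels.

Section CauchyEstimate.
Variables (R : realType) (V : normedModType R[i]).
Implicit Types f : R[i] -> V.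

(** The derivative at 0 is read off from f z / z ^ 2. Around a tiny square,
    f z = f 0 + z d + o(z), where f 0 / z ^ 2 sums to 0 by parity, d / z sums to
    at least 4 |d|, and the error is negligible. The same sum taken around the
    square of half side r is at most its length 8 r times B / r ^ 2. *)
Lemma cauchy_estimate0 f (r B : R) d : 0 < r ->
  (forall z, `|complex.Re z| <= r -> `|complex.Im z| <= r -> exists d, has_deriv f z d) ->
  has_deriv f 0 d ->
  (forall z, on_boundary (- r) (- r) (2 * r) z -> nm (f z) <= B) ->
  nm d <= 2 * B / r.
Proof.
move=> r0 fd f0 fB; apply/ler_addgt0Pr => e e0.
have bnd (s : R) z : 0 < s -> on_boundary (- s) (- s) (2 * s) z -> s <= modulus z <= 2 * s.
  move=> s0; have := Re_le_modulus z; have := Im_le_modulus z; have := modulus_le_ReIm z.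
  rewrite !ler_norml => + /andP[? ?] /andP[? ?] [[? ? ? ?] zb].
  have : `|complex.Re z| <= s by rewrite ler_norml; apply/andP; split; lra.
  have : `|complex.Im z| <= s by rewrite ler_norml; apply/andP; split; lra.
  by move=> h1 h2 h3; apply/andP; split; [case: zb => *; lra|lra].
pose g z := z^-1 *: (z^-1 *: f z).
pose er z := f z - f 0 - z *: d.
pose e1 := e / 3.
have e10 : 0 < e1 by rewrite divr_gt0.
have [dl dl0 dlP] := f0 e1 e10.
have [k kP] : exists k, 2 * (r / 2 ^+ k) < dl.
  have [k /ltW kP] : exists k, 2 * r / dl < k%:R.
    by exists (Num.bound (2 * r / dl)); rewrite archi_boundP// divr_ge0 ?mulr_ge0// ltW.
  exists k; rewrite mulrA ltr_pdivrMr ?exprn_gt0// [ltRHS]mulrC -ltr_pdivrMr//.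
  by apply: le_lt_trans kP _; rewrite -natrX ltr_nat ltn_expl.
pose s := r / 2 ^+ k.
have s0 : 0 < s by rewrite divr_gt0 ?exprn_gt0.
have [n0 n0P] : exists n0, forall n, (n0 <= n)%N -> nm (csum g (n + k)%N r - csum g n s) <= e1.
  apply: csum_shrink => // z z0 z1 z2; have [d' d'P] := fd z z1 z2.
  by eexists; do 2!apply: has_derivM (has_deriv_inv z0) _; exact: d'P.
have {n0P} h1 := n0P n0 (leqnn _).
have h2 : nm (csum g (n0 + k)%N r) <= 8 * B / r.
  have -> : 8 * B / r = 8 * r * (r^-1 * (r^-1 * B)) by field; rewrite gt_eqF.
  apply: csum_bound => // z zb; have /andP[z1 _] := bnd r z r0 zb.
  have B0 : 0 <= B by apply: le_trans (fB z zb); exact: nm_ge0.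
  have iz : (modulus z)^-1 <= r^-1 by rewrite lef_pV2// posrE; apply: lt_le_trans z1.
  rewrite !nmZ modulusV.
  have iz0 : 0 <= (modulus z)^-1 by rewrite invr_ge0 modulus_ge0.
  rewrite ler_pM ?mulr_ge0 ?nm_ge0//; rewrite ler_pM ?nm_ge0//; exact: fB.
have h3 : csum g n0 s = csum ((fun z => z^-1) : R[i] -> R[i]^o) n0 s *: d
    + csum (fun z => z^-1 *: (z^-1 *: er z)) n0 s.
  have -> : g = fun z => ((z^-1 * z^-1) *: f 0 + z^-1 *: d) + z^-1 *: (z^-1 *: er z).
    apply/funext => z; rewrite /g /er !scalerBr !scalerA.
    have -> : z^-1 * z^-1 * z = z^-1.
      by rewrite -mulrA; have [->|z0] := eqVneq z 0; [rewrite invr0 !mul0r|rewrite mulVf// mulr1].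
    by rewrite -(addrA (_ *: f z)) -opprD [RHS]addrC subrK.
  rewrite /csum !square_sumD !square_sum_scale -/(csum _ _ _) csum_even ?scale0r ?add0r//.
  by move=> z; rewrite invrN mulrNN.
have h4 : nm (csum (fun z => z^-1 *: (z^-1 *: er z)) n0 s) <= 8 * e1.
  have -> : 8 * e1 = 8 * s * (s^-1 * e1) by field; rewrite gt_eqF.
  apply: csum_bound => // z zb; have /andP[z1 z2] := bnd s z s0 zb.
  have zpos : 0 < modulus z by exact: lt_le_trans z1.
  have iz : (modulus z)^-1 <= s^-1 by rewrite lef_pV2// posrE; apply: lt_le_trans z1.
  have := dlP z ltac:(by apply: le_lt_trans kP); rewrite add0r -/(er z) => erz.
  rewrite !nmZ modulusV; rewrite ler_pM// ?mulr_ge0 ?invr_ge0 ?nm_ge0 ?modulus_ge0//.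
  by rewrite mulrC ler_pdivrMr.
have h5 : 4 * nm d <= nm (csum ((fun z => z^-1) : R[i] -> R[i]^o) n0 s *: d).
  rewrite nmZ ler_wpM2r ?nm_ge0//; apply: le_trans (csum_inv n0 s0) _.
  exact: le_trans (ler_norm _) (Im_le_modulus _).
have h6 := nmB (csum g n0 s) (csum (fun z => z^-1 *: (z^-1 *: er z)) n0 s).
rewrite {1}h3 addrK in h6.
have h7 := nmB (csum g (n0 + k)%N r) (csum g (n0 + k)%N r - csum g n0 s).
rewrite opprB addrC subrK in h7.
have -> : 2 * B / r = 8 * B / r / 4 by field; rewrite gt_eqF.
rewrite /e1 in h1 h4; lra.
Qed.

Lemma has_deriv_shift f p z d : has_deriv f (z + p) d -> has_deriv (fun w => f (w + p)) z d.
Proof.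
move=> fd e /fd[dl dl0 dlP]; exists dl => // h /dlP.
by rewrite (addrAC z).
Qed.

Lemma cauchy_estimate f p (r B : R) d : 0 < r ->
  (forall z, `|complex.Re (z - p)| <= r -> `|complex.Im (z - p)| <= r ->
     exists d, has_deriv f z d) ->
  has_deriv f p d ->
  (forall z, on_boundary (- r) (- r) (2 * r) (z - p) -> nm (f z) <= B) ->
  nm d <= 2 * B / r.
Proof.
move=> r0 fd fp fB; apply: (@cauchy_estimate0 (fun z => f (z + p))) => //.
- move=> z z1 z2; have [|//|d' d'P] := fd (z + p); rewrite ?addrK//.
  by exists d'; exact: has_deriv_shift.
- by apply: has_deriv_shift; rewrite add0r.
- by move=> z zb; apply: fB; rewrite addrK.
Qed.

End CauchyEstimate.

(** * The mean value inequality *)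

Section MeanValue.
Variables (R : realType) (V : normedModType R[i]).
Implicit Types f : R[i] -> V.

(** The inequality is additive under bisection of the segment, and holds up to e
    on small subsegments by differentiability. The parameter of the segment is
    the first coordinate of the unit square. *)
Lemma mean_value_inequality f (w w' : R[i]) (L : R) :
  (forall t : R, 0 <= t <= 1 -> exists2 d, has_deriv f (w' + t%:C * (w - w')) d & nm d <= L) ->
  nm (f w - f w') <= L * modulus (w - w').
Proof.
move=> fd; have [->|ww'] := eqVneq w w'.
  by rewrite !subrr nm0 modulus0 mulr0.
pose m := modulus (w - w').
have m0 : 0 < m by rewrite modulus_gt0 subr_eq0.
pose g (t : R) := f (w' + t%:C * (w - w')).
apply/ler_addgt0Pr => e0 e00; pose e := e0 / m.
have egt0 : 0 < e by rewrite divr_gt0.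
have -> : L * m + e0 = (L + e) * m * 1 by rewrite /e; field; rewrite gt_eqF.
have -> : f w - f w' = g (0 + 1) - g 0.
  by rewrite /g add0r mul1r mul0r addr0 (addrC w') subrK.
apply: (square_bisection (y0 := 0)
  (P := fun x _ s => nm (g (x + s) - g x) <= (L + e) * m * s)) => //.
  move=> x _ s s0 h1 h2 _ _; apply: le_trans (nmtri _ (g (x + s / 2)) _) _.
  have e1 : x + s / 2 + s / 2 = x + s by field.
  rewrite e1 in h2; have -> : (L + e) * m * s = (L + e) * m * (s / 2) + (L + e) * m * (s / 2) by field.
  exact: lerD.
move=> u v [u0 u1 _ _]; rewrite add0r in u1.
have [d dP dL] := fd u ltac:(by rewrite u0 u1).
have [dl dl0 dlP] := dP e egt0.
exists (dl / m); first by rewrite divr_gt0.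
move=> x _ s /andP[s0 sdl] [xu ux _ _] _ _.
have near_u y : x <= y <= x + s ->
    nm (g y - g u - ((y - u)%:C * (w - w')) *: d) <= e * (`|y - u| * m).
  move=> /andP[xy ys]; have ys' : `|y - u| <= s by rewrite ler_norml; apply/andP; split; lra.
  have := dlP ((y - u)%:C * (w - w')); rewrite modulusM modulus_real -/m => /(_ _).
  rewrite -(addrA w') -mulrDl -rmorphD (addrC u) subrK; apply.
  by apply: le_lt_trans (ler_wpM2r (ltW m0) ys') _; rewrite -ltr_pdivlMr.
have h1 := near_u (x + s) ltac:(lra).
have h2 := near_u x ltac:(lra).
have -> : g (x + s) - g x = (g (x + s) - g u - ((x + s - u)%:C * (w - w')) *: d)
   - (g x - g u - ((x - u)%:C * (w - w')) *: d) + (s%:C * (w - w')) *: d.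
  have -> : (x + s - u)%:C * (w - w') = s%:C * (w - w') + (x - u)%:C * (w - w').
    by rewrite -mulrDl -rmorphD; congr (_%:C * _); ring.
  rewrite scalerDl !opprD !opprK !addrA.
  rewrite [RHS](ACl (1*5*(2*6)*(4*7)*(3*8))) /=.
  by rewrite !addNr !addr0.
apply: le_trans (nmD _ _) _; apply: le_trans (lerD (nmB _ _) (lexx _)) _.
rewrite nmZ modulusM modulus_real gtr0_norm// -/m.
apply: le_trans (lerD (lerD h1 h2) (ler_wpM2l _ dL)) _; first by rewrite mulr_ge0 ?ltW.
rewrite [`|x + s - u|]ger0_norm ?[`|x - u|]ler0_norm; [|lra|lra].
by rewrite le_eqVlt; apply/orP; left; apply/eqP; ring.
Qed.

End MeanValue.

(** * Solving (T - z) f = g near a point with bounded below annuli *)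

Section DerivB.
Variables (R : realType) (V : normedModType R[i]).

Lemma has_derivB (f g : R[i] -> V) z d d' : has_deriv f z d -> has_deriv g z d' ->
  has_deriv (fun w => f w - g w) z (d - d').
Proof.
move=> fd gd e e0; have e2 : 0 < e / 2 by rewrite divr_gt0.
have [d1 d10 d1P] := fd _ e2; have [d2 d20 d2P] := gd _ e2.
exists (Num.min d1 d2); first by rewrite lt_min d10.
move=> h; rewrite lt_min => /andP[/d1P h1 /d2P h2].
have -> : f (z + h) - g (z + h) - (f z - g z) - h *: (d - d') =
  (f (z + h) - f z - h *: d) - (g (z + h) - g z - h *: d').
  by rewrite scalerBr !opprD !opprK !addrA (ACl (1*3*5*2*4*6)).
by apply: le_trans (nmB _ _) _; lra.
Qed.

End DerivB.

Section AnnularBound.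
Variables (R : realType) (H : completeNormedModType R[i]).
Variable T : {linear H -> H}.
Implicit Types (f g : R[i] -> H) (z w : R[i]).

Definition bounded_below_by (c : R) z := forall x, c * nm x <= nm (T x - z *: x).

Definition bounded_below_at z := exists2 c, 0 < c & bounded_below_by c z.

(** T - z is bounded below, uniformly, on each small annulus around z0, with
    nothing asked at z0 itself. The outer radius 6 r is such that the annulus
    contains the part outside the disc of radius r of a square of half side 3 r. *)
Definition bounded_below_around z0 := exists2 r0 : R, 0 < r0 & forall r, 0 < r < r0 ->
  exists2 c, 0 < c & forall z, r <= modulus (z - z0) <= 6 * r -> bounded_below_by c z.

Lemma bounded_below_around_at z0 : bounded_below_at z0 -> bounded_below_around z0.
Proof.
move=> [c c0 cP]; exists (c / 12); first by rewrite divr_gt0.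
move=> r /andP[r0 rc]; exists (c / 2); first by rewrite divr_gt0.
move=> z /andP[_ z6] x.
have e : T x - z0 *: x = (T x - z *: x) + (z - z0) *: x.
  by rewrite scalerBl addrA subrK.
have := cP x; rewrite e => /le_trans/(_ (nmD _ _)); rewrite nmZ.
have h : modulus (z - z0) * nm x <= c / 2 * nm x.
  by rewrite ler_wpM2r ?nm_ge0//; lra.
by move=> h'; lra.
Qed.

Definition box z0 (r : R) : set R[i] :=
  [set z | `|complex.Re (z - z0)| <= r /\ `|complex.Im (z - z0)| <= r].

Lemma box3 z0 (r : R) z : 0 < r -> box z0 r z -> box z0 (3 * r) z.
Proof. by move=> r0 [z1 z2]; split; [apply: le_trans z1 _|apply: le_trans z2 _]; lra. Qed.

Lemma ReB z w : complex.Re (z - w) = complex.Re z - complex.Re w.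
Proof. by case: z; case: w. Qed.

Lemma ImB z w : complex.Im (z - w) = complex.Im z - complex.Im w.
Proof. by case: z; case: w. Qed.

Lemma ReD z w : complex.Re (z + w) = complex.Re z + complex.Re w.
Proof. by case: z; case: w. Qed.

Lemma ImD z w : complex.Im (z + w) = complex.Im z + complex.Im w.
Proof. by case: z; case: w. Qed.

Lemma ReMr (t : R) w : complex.Re (t%:C * w) = t * complex.Re w.
Proof. by case: w => a b /=; ring. Qed.

Lemma ImMr (t : R) w : complex.Im (t%:C * w) = t * complex.Im w.
Proof. by case: w => a b /=; ring. Qed.

Section Estimate.
Variables (z0 : R[i]) (r c e : R) (phi : R[i] -> H).
Hypotheses (r_gt0 : 0 < r) (c_gt0 : 0 < c).
Hypothesis bound : forall z, r <= modulus (z - z0) <= 6 * r -> bounded_below_by c z.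
Hypothesis phi_deriv : forall z, box z0 (3 * r) z -> exists d, has_deriv phi z d.
Hypothesis phi_bound : forall z, box z0 (3 * r) z -> nm (T (phi z) - z *: phi z) <= e.

(** On the annulus, a bound on (T - z) phi is a bound on phi; the next lemmas
    transport it to the hole. Squares of half side 2 r centred in the inner box
    have their boundary in the annulus, so Cauchy's estimate bounds phi' there. *)
Lemma annulus_estimate z : box z0 (3 * r) z -> r <= modulus (z - z0) -> nm (phi z) <= e / c.
Proof.
move=> zb rz; rewrite ler_pdivlMr// mulrC; apply: le_trans (phi_bound zb).
apply: bound; rewrite rz /=; case: zb => z1 z2.
by apply: le_trans (modulus_le_ReIm _) _; lra.
Qed.

Lemma deriv_estimate w d : box z0 r w -> has_deriv phi w d -> nm d <= e / c / r.
Proof.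
move=> [w1 w2] dP; move: w1 w2; rewrite ReB ImB !ler_norml => /andP[? ?] /andP[? ?].
have -> : e / c / r = 2 * (e / c) / (2 * r) by field; rewrite !gt_eqF.
apply: (cauchy_estimate (f := phi) (p := w)) => //; first by rewrite mulr_gt0.
  move=> z; rewrite ReB ImB !ler_norml => /andP[? ?] /andP[? ?].
  by apply: phi_deriv; split; rewrite ?ReB ?ImB ler_norml; apply/andP; split; lra.
move=> z [[]]; rewrite ReB ImB => ? ? ? ? zb; apply: annulus_estimate.
  by split; rewrite ?ReB ?ImB ler_norml; apply/andP; split; lra.
have := Re_le_modulus (z - z0); have := Im_le_modulus (z - z0).
rewrite ReB ImB !ler_norml => /andP[? ?] /andP[? ?].
by case: zb; lra.
Qed.

Lemma lipschitz_estimate w w' : box z0 r w -> box z0 r w' ->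
  nm (phi w - phi w') <= e / c / r * modulus (w - w').
Proof.
move=> [w1 w2] [w3 w4]; apply: mean_value_inequality => t /andP[t0 t1].
move: w1 w2 w3 w4; rewrite !ReB !ImB !ler_norml => /andP[? ?] /andP[? ?] /andP[? ?] /andP[? ?].
have tb : box z0 r (w' + t%:C * (w - w')).
  by split; rewrite ?ReB ?ImB ?ReD ?ImD ?ReMr ?ImMr ?ReB ?ImB ler_norml; apply/andP; split; nra.
have [d dP] : exists d, has_deriv phi (w' + t%:C * (w - w')) d.
  by apply: phi_deriv; exact: box3.
by exists d => //; exact: deriv_estimate dP.
Qed.

(** A substitute for the maximum principle: phi is Lipschitz on the inner box, and
    bounded at z0 + r, which lies in the annulus. *)
Lemma interior_estimate w : box z0 r w -> nm (phi w) <= 4 * e / c.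
Proof.
(* w' is a point of the box that already lies in the annulus *)
move=> wb; have [w' w'E] : exists w', w' = z0 + r%:C by eexists.
have w'b : box z0 r w'.
  by split; rewrite w'E (addrC z0) addrK /=; [rewrite gtr0_norm|rewrite normr0 ltW].
have h1 : nm (phi w') <= e / c.
  apply: annulus_estimate; first exact: box3.
  by rewrite w'E (addrC z0) addrK modulus_real gtr0_norm.
have h2 := lipschitz_estimate wb w'b.
have e0 : 0 <= e / c by apply: le_trans h1; exact: nm_ge0.
have h3 : modulus (w - w') <= 3 * r.
  apply: le_trans (modulus_le_ReIm _) _; case: wb; rewrite w'E.
  rewrite !ReB !ImB !ReD !ImD /= !ler_norml => /andP[? ?] /andP[? ?].
  have : `|complex.Re w - (complex.Re z0 + r)| <= 2 * r.
    by rewrite ler_norml; apply/andP; split; lra.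
  have : `|complex.Im w - (complex.Im z0 + 0)| <= r.
    by rewrite ler_norml; apply/andP; split; lra.
  by lra.
have h4 : e / c / r * modulus (w - w') <= 3 * (e / c).
  have -> : 3 * (e / c) = e / c / r * (3 * r) by field; rewrite !gt_eqF.
  by rewrite ler_wpM2l// divr_ge0// ltW.
have -> : 4 * e / c = 3 * (e / c) + e / c by field; rewrite gt_eqF.
have -> : phi w = (phi w - phi w') + phi w' by rewrite subrK.
by apply: le_trans (nmD _ _) _; lra.
Qed.

End Estimate.

Lemma nm_cvg_le (u : nat -> H) (l a : H) (b : R) n0 : u @ \oo --> l ->
  (forall n, (n0 <= n)%N -> nm (u n - a) <= b) -> nm (l - a) <= b.
Proof.
move=> /cvgn_nmP ul ub; apply/ler_addgt0Pr => e /ul[n1 n1P].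
have h1 := n1P (maxn n0 n1) (leq_maxr _ _); have h2 := ub (maxn n0 n1) (leq_maxl _ _).
apply: le_trans (nmtri _ (u (maxn n0 n1)) _) _; rewrite nmC; lra.
Qed.

Lemma harmonic_small (K e : R) : 0 < e -> exists n0, forall n, (n0 <= n)%N -> K / n.+1%:R < e.
Proof.
move=> e0; have [K0|K0] := leP K 0.
  by exists 0%N => n _; apply: le_lt_trans e0; rewrite pmulr_lle0// invr_gt0 ltr0n.
exists (Num.bound (K / e)) => n nb; rewrite ltr_pdivrMr ?ltr0n// mulrC -ltr_pdivrMr//.
apply: lt_le_trans (archi_boundP _) _; first by rewrite divr_ge0 ?ltW.
by rewrite ler_nat; exact: leqW.
Qed.

Lemma harmonic_le (m n : nat) : (m <= n)%N -> n.+1%:R^-1 <= m.+1%:R^-1 :> R.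
Proof. by move=> mn; rewrite lef_pV2 ?posrE ?ltr0n// ler_nat ltnS. Qed.

(** Approximate solutions fs converge to an exact one, even across points where
    T - z is not bounded below. By the estimates above, applied to differences
    fs m - fs n, the functions, their derivatives and their difference quotients
    are all uniformly Cauchy on the inner box; the last point makes the limit
    differentiable. *)
Lemma local_solution (M r c : R) z0 g (fs : nat -> R[i] -> H) :
  0 < M -> (forall x, nm (T x) <= M * nm x) -> 0 < r -> 0 < c ->
  (forall z, r <= modulus (z - z0) <= 6 * r -> bounded_below_by c z) ->
  (forall n z, box z0 (3 * r) z -> exists d, has_deriv (fs n) z d) ->
  (forall n z, box z0 (3 * r) z -> nm (T (fs n z) - z *: fs n z - g z) <= n.+1%:R^-1) ->
  exists f, forall w, `|complex.Re (w - z0)| < r -> `|complex.Im (w - z0)| < r ->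
    (exists d, has_deriv f w d) /\ T (f w) - w *: f w = g w.
Proof.
move=> M0 TM r0 c0 bnd fd fg.
pose h n : R := n.+1%:R^-1.
have h0 n : 0 < h n by rewrite invr_gt0 ltr0n.
pose phi m n z := fs m z - fs n z.
have phid m n z : box z0 (3 * r) z -> exists d, has_deriv (phi m n) z d.
  move=> zb; have [d1 D1] := fd m z zb; have [d2 D2] := fd n z zb.
  by exists (d1 - d2); exact: has_derivB.
have phib m n z : box z0 (3 * r) z -> nm (T (phi m n z) - z *: phi m n z) <= h m + h n.
  move=> zb; rewrite /phi linearB scalerBr.
  have -> : T (fs m z) - T (fs n z) - (z *: fs m z - z *: fs n z) =
    (T (fs m z) - z *: fs m z - g z) - (T (fs n z) - z *: fs n z - g z).
    by rewrite !opprD !opprK !addrA [RHS](ACl (1*4*2*5*(3*6))) /= addNr addr0.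
  by apply: le_trans (nmB _ _) _; apply: lerD; exact: fg.
have phi2 m n : (n <= m)%N -> h m + h n <= 2 * h n.
  by move=> /harmonic_le; rewrite -/(h m) -/(h n); lra.
have K0 : 0 < 8 / c by rewrite divr_gt0.
have est m n w : box z0 r w -> (n <= m)%N -> nm (fs m w - fs n w) <= 8 / c * h n.
  move=> wb nm; apply: le_trans (interior_estimate r0 c0 bnd (phid m n) (phib m n) wb) _.
  have -> : 8 / c * h n = 4 * (2 * h n) / c by field; rewrite gt_eqF.
  by rewrite ler_pM2r ?invr_gt0// ler_pM2l// phi2.
have flim w : exists l, box z0 r w -> (fun n => fs n w) @ \oo --> (l : H).
  have [wb|nwb] := pselect (box z0 r w); last by exists 0.
  have [|l lP] := @cauchy_nm R H (fun n => fs n w); last by exists l.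
  move=> e e0; have [n0 n0P] := harmonic_small (8 / c) e0.
  exists n0 => m n n0m n0n; wlog mn : m n n0m n0n / (n <= m)%N.
    by move=> W; have [/W|/ltnW/W] := leqP n m; [apply|rewrite nmC; apply].
  exact: le_lt_trans (est _ _ _ wb mn) (n0P _ n0n).
have [f fP] := choice flim.
exists f => w w1 w2; have wb : box z0 r w by split; exact: ltW.
have fest n : nm (f w - fs n w) <= 8 / c * h n.
  by apply: nm_cvg_le (fP _ wb) _ => m; exact: est.
split; last first.
  apply/eqP; rewrite -subr_eq0; apply/eqP/nm0_eq0/eqP; rewrite eq_le nm_ge0 andbT.
  apply/ler_addgt0Pr => e e0; rewrite add0r.
  pose K := (M + modulus w) * (8 / c) + 1.
  have [n nP] := harmonic_small K e0; have {}nP := nP n (leqnn _).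
  apply/ltW; apply: le_lt_trans nP.
  have -> : T (f w) - w *: f w - g w = T (f w - fs n w) - w *: (f w - fs n w)
     + (T (fs n w) - w *: fs n w - g w).
    rewrite linearB scalerBr !opprD !opprK !addrA.
    by rewrite [RHS](ACl (1*3*7*(2*5)*(4*6))) /= addNr subrr !addr0.
  apply: le_trans (nmD _ _) _.
  have -> : K / n.+1%:R = (M * (8 / c * h n) + modulus w * (8 / c * h n)) + h n.
    by rewrite /K /h; ring.
  apply: lerD; last by apply: fg; exact: box3.
  apply: le_trans (nmB _ _) _; apply: lerD.
    by apply: le_trans (TM _) _; rewrite ler_pM2l.
  by rewrite nmZ ler_wpM2l// modulus_ge0.
have wb3 : box z0 (3 * r) w by exact: box3.
have [d dP] := choice (fun n => fd n w wb3).
pose L := 2 / (c * r).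
have L0 : 0 < L by rewrite divr_gt0// mulr_gt0.
have dest m n : (n <= m)%N -> nm (d m - d n) <= L * h n.
  move=> nm; have := deriv_estimate r0 c0 bnd (phid m n) (phib m n) wb (has_derivB (dP m) (dP n)).
  move=> /le_trans; apply; have -> : L * h n = 2 * h n / c / r by rewrite /L; field; rewrite !gt_eqF.
  by do 2!rewrite ler_pM2r ?invr_gt0//; exact: phi2.
have [|dl dlP] := @cauchy_nm R H d.
  move=> e e0; have [n0 n0P] := harmonic_small L e0.
  exists n0 => m n n0m n0n; wlog mn : m n n0m n0n / (n <= m)%N.
    by move=> W; have [/W|/ltnW/W] := leqP n m; [apply|rewrite nmC; apply].
  exact: le_lt_trans (dest _ _ mn) (n0P _ n0n).
have dlest n : nm (dl - d n) <= L * h n.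
  by apply: nm_cvg_le dlP _ => m; exact: dest.
have lip n w' : box z0 r w' -> nm (f w' - (fs n w' + (f w - fs n w))) <= L * h n * modulus (w' - w).
  move=> w'b; apply/ler_addgt0Pr => e e0.
  have /cvgn_nmP/(_ (e / 2))[|n1 n1P] := fP _ wb; first by rewrite divr_gt0.
  have /cvgn_nmP/(_ (e / 2))[|n2 n2P] := fP _ w'b; first by rewrite divr_gt0.
  pose m := maxn n (maxn n1 n2).
  have n_m : (n <= m)%N by exact: leq_maxl.
  have {}n1P := n1P m ltac:(by rewrite /m !leq_max leqnn !orbT).
  have {}n2P := n2P m ltac:(by rewrite /m !leq_max leqnn !orbT).
  have := lipschitz_estimate r0 c0 bnd (phid m n) (phib m n) w'b wb; rewrite /phi => h1.
  have {}h1 : nm (fs m w' - fs n w' - (fs m w - fs n w)) <= L * h n * modulus (w' - w).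
    apply: le_trans h1 _; rewrite ler_wpM2r ?modulus_ge0//.
    have -> : L * h n = 2 * h n / c / r by rewrite /L; field; rewrite !gt_eqF.
    by do 2!rewrite ler_pM2r ?invr_gt0//; exact: phi2.
  have -> : f w' - (fs n w' + (f w - fs n w)) =
     (fs m w' - fs n w' - (fs m w - fs n w)) - (fs m w' - f w') + (fs m w - f w).
    rewrite !opprD !opprK !addrA.
    by rewrite [RHS](ACl (6*2*8*4*(1*5)*(3*7))) /= subrr addNr !addr0.
  apply: le_trans (nmD _ _) _; apply: le_trans (lerD (nmB _ _) (lexx _)) _.
  by apply: le_trans (lerD (lerD h1 (ltW n2P)) (ltW n1P)) _; lra.
(* compare the difference quotient of f with that of one fs n *)
exists dl => e e0.
have e3 : 0 < e / 3 by rewrite divr_gt0.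
have [n nP] := harmonic_small L e3.
have {}nP : L * h n < e / 3 := nP n (leqnn _).
have [del del0 delP] := dP n _ e3.
pose del' := Num.min (r - `|complex.Re (w - z0)|) (r - `|complex.Im (w - z0)|).
exists (Num.min del del'); first by rewrite !lt_min del0 !subr_gt0 w1 w2.
move=> k; rewrite !lt_min => /and3P[/delP k1 k2 k3].
have w'b : box z0 r (w + k).
  split; rewrite addrAC ?(ReD (w - z0)) ?(ImD (w - z0)); apply: le_trans (ler_normD _ _) _.
    by apply: le_trans (lerD (lexx _) (Re_le_modulus k)) _; rewrite -lerBrDl ltW.
  by apply: le_trans (lerD (lexx _) (Im_le_modulus k)) _; rewrite -lerBrDl ltW.
have := lip n _ w'b; rewrite [w + k]addrC addrK => k4.
have -> : f (k + w) - f w - k *: dl = (f (k + w) - (fs n (k + w) + (f w - fs n w)))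
   + (fs n (k + w) - fs n w - k *: d n) - k *: (dl - d n).
  rewrite scalerBr !opprD !opprK !addrA.
  by rewrite [RHS](ACl (1*3*8*(2*5)*(4*6)*(7*9))) /= !addNr subrr !addr0.
rewrite [w + k]addrC in k1.
apply: le_trans (nmB _ _) _; apply: le_trans (lerD (nmD _ _) (lexx _)) _.
rewrite nmZ.
have k5 : modulus k * nm (dl - d n) <= modulus k * (L * h n).
  by rewrite ler_wpM2l ?modulus_ge0.
have k6 : L * h n * modulus k <= e / 3 * modulus k by rewrite ler_wpM2r ?modulus_ge0// ltW.
lra.
Qed.

End AnnularBound.

(** * Bishop's property (beta) from bounds on annuli *)

Section BishopEps.
Variables (R : realType) (H : completeNormedModType R[i]).
Implicit Types (f g : R[i]^o -> H) (z w : R[i]^o) (U V : set R[i]^o).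

Lemma analyticP U f : analytic_on U f <-> forall z, U z -> exists d, has_deriv f z d.
Proof. by split=> fa z /fa /derivable_nmP. Qed.

Lemma has_deriv_near f g z d (dl : R) : 0 < dl ->
  (forall w : R[i], modulus (w - z) < dl -> f w = g w) -> has_deriv g z d -> has_deriv f z d.
Proof.
move=> dl0 fg gd e /gd[d1 d10 d1P]; exists (Num.min dl d1); first by rewrite lt_min dl0.
move=> h; rewrite lt_min => /andP[h1 /d1P]; rewrite -!fg//.
  by rewrite subrr modulus0.
by rewrite addrC addKr.
Qed.

Lemma has_deriv_linear (T : {linear H -> H}) f z d : continuous T ->
  has_deriv f z d -> has_deriv (fun w => T (f w)) z (T d).
Proof.
move=> /linear_nmP-/(_ (@linearP _ _ _ _ T))[M M0 TM] fd e e0.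
have [dl dl0 dlP] := fd (e / M) ltac:(by rewrite divr_gt0).
exists dl => // h /dlP h1; rewrite -linearZ -!linearB; apply: le_trans (TM _) _.
by rewrite mulrC -ler_pdivlMr// mulrAC.
Qed.

Lemma has_deriv_id z : has_deriv (id : R[i] -> R[i]^o) z 1.
Proof.
move=> e e0; exists 1 => // h _.
rewrite [h *: 1]mulr1 /= (addrC z) addrK subrr nm0 mulr_ge0 ?(ltW e0)//; exact: modulus_ge0.
Qed.

Lemma box_compact z (r : R) : compact (box z r : set R[i]^o).
Proof.
pose F (p : R * R) : R[i]^o := z + (p.1 +i* p.2).
have -> : box z r = F @` (`[- r, r] `*` `[- r, r]).
  apply/seteqP; split => [w [w1 w2]|_ [[a b] [/= a1 b1] <-]].
    exists (complex.Re (w - z), complex.Im (w - z)).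
      by split; rewrite /= in_itv /= -ler_norml.
    by rewrite /F /= (_ : _ +i* _ = w - z) ?(addrC z) ?subrK//; case: (w - z).
  by split; rewrite /F (addrC z) addrK /= ler_norml; [move: a1|move: b1]; rewrite in_itv.
apply: continuous_compact; last by apply: compact_setX; exact: segment_compact.
apply: continuous_subspaceT => -[a b] P /nbhs_modP[d d0 dP].
have d2 : 0 < d / 2 by rewrite divr_gt0.
exists (ball a (d / 2), ball b (d / 2)); first by split; exact: nbhsx_ballx.
move=> [x y] [/= xa yb]; apply: dP; rewrite /F opprD addrACA subrr add0r.
apply: le_lt_trans (modulus_le_ReIm _) _ => /=.
rewrite -!ball_normE /= in xa yb; rewrite distrC in xa; rewrite distrC in yb; lra.
Qed.

Section Closed.
Variable T : {linear H -> H}.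
Hypothesis T_cont : continuous T.

(** Membership in the closure of the range of T_U, spelled out for the topology
    of uniform convergence on compact subsets. *)
Definition approximable U g := forall K : set R[i]^o, K `<=` U -> compact K ->
  forall e : R, 0 < e -> exists2 f, analytic_on U f &
     forall z, K z -> nm (TU T f z - g z) < e.

Lemma analytic_TU U f : analytic_on U f -> analytic_on U (TU T f).
Proof.
move=> /analyticP fa; apply/analyticP => z /fa[d dP].
eexists; apply: has_derivB; first exact: has_deriv_linear dP.
exact: has_derivM (has_deriv_id z) dP.
Qed.

Lemma closure_rangeP U g :
  closure (range_TU T U : set {family compactly_in U, R[i]^o -> H}) g <-> approximable U g.
Proof.
split.
  move=> gcl K KU Kc e e0.
  pose E := [set xy : H * H | ball xy.1 e%:C xy.2].
  have e0' : 0 < e%:C by rewrite ltcR.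
  have Ee : entourage E by exact: (entourage_ball H (PosNum e0')).
  have [h [[_ [f fa fh]] hE]] := gcl _ (@fam_nbhs _ _ (compactly_in U) K E g Ee (conj KU Kc)).
  exists f => // z Kz; rewrite fh; last exact: KU.
  by have := hE z Kz; rewrite /E /= -ball_normE /= nmE ltcR nmC.
move=> ga B gB.
pose D := [set Ke : set R[i]^o * R | [/\ Ke.1 `<=` U, compact Ke.1 & 0 < Ke.2]].
pose N (Ke : set R[i]^o * R) : set (R[i]^o -> H) :=
  [set h | range_TU T U h /\ forall z, Ke.1 z -> nm (h z - g z) < Ke.2].
pose F : set_system (R[i]^o -> H) := filter_from D N.
(* F is the trace on the range of the neighbourhoods of g *)
have FF : ProperFilter F.
  apply: filter_from_proper; last first.
    move=> [K e] [/= KU Kc e0]; have [f fa fP] := ga K KU Kc e e0.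
    by exists (TU T f); split=> //; split; [exact: analytic_TU|exists f].
  apply: filter_from_filter.
    exists (set0, 1); split=> //=; exact: compact0.
  move=> [K1 e1] [K2 e2] [/= K1U K1c e10] [/= K2U K2c e20].
  exists (K1 `|` K2, Num.min e1 e2).
    by split=> /=; [rewrite subUset|exact: compactU|rewrite lt_min e10].
  by move=> h [hr hP]; split; split=> // z Kz;
    have := hP z ltac:(by [left|right]); rewrite lt_min => /andP[].
have : {family compactly_in U, F --> g}.
  apply/fam_cvgP => K [KU Kc] P /uniform_nbhs[E [+ EP]].
  rewrite -entourage_ballE => -[_ /= /gt0_complexP[e e0 ->] eE].
  exists (K, e) => // h [_ hP]; apply: EP => z Kz; apply: eE => /=.
  by rewrite -ball_normE /= nmE ltcR nmC; exact: hP.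
move=> /(_ B gB)[Ke KeD KeB].
by have [h [hr hP]] := @filter_ex _ F FF (N Ke) ltac:(by exists Ke); exists h; split=> //; apply: KeB.
Qed.

Lemma injective_TUP U : injective_TU T U <->
  forall f, analytic_on U f -> (forall z, U z -> TU T f z = 0) -> forall z, U z -> f z = 0.
Proof.
split=> inj.
  move=> f fa f0; apply: (inj f (fun=> 0)) => //.
  by move=> z /f0 ->; rewrite /TU linear0 scaler0 subr0.
move=> f g fa ga fg z Uz; apply/eqP; rewrite -subr_eq0; apply/eqP.
apply: (inj (fun w => f w - g w)) => // [|w Uw].
  apply/analyticP => w Uw; have [d1 D1] := (analyticP _ _).1 fa w Uw.
  by have [d2 D2] := (analyticP _ _).1 ga w Uw; exists (d1 - d2); exact: has_derivB.
have /eqP := fg w Uw; rewrite /TU linearB scalerBr -subr_eq0 => /eqP <-.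
by rewrite !opprD !opprK !addrA [RHS](ACl (1*3*2*4)).
Qed.

Lemma closed_range_TUP U : closed_range_TU T U <->
  forall g, analytic_on U g -> approximable U g ->
    exists2 f, analytic_on U f & forall z, U z -> TU T f z = g z.
Proof.
split=> [cl g ga /closure_rangeP gcl|cl g [ga /closure_rangeP gcl]].
  by have [_ [f fa fP]] := cl g (conj ga gcl); exists f.
by split=> //; exact: cl.
Qed.

Lemma approximableS U V g : V `<=` U -> approximable U g -> approximable V g.
Proof.
move=> VU ga K KV Kc e e0; have [|f fa fP] := ga K _ Kc e e0.
  exact: subset_trans KV VU.
by exists f => // z /VU; exact: fa.
Qed.

(** Injectivity on open subsets forces local solutions of (T - z) f = g to agree
    on overlaps. *)
Lemma glue_solutions U g : (forall V, open V -> V `<=` U -> injective_TU T V) ->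
  (forall z, U z -> exists V, [/\ open V, V `<=` U, V z &
     exists2 f, analytic_on V f & forall w, V w -> TU T f w = g w]) ->
  exists2 f, analytic_on U f & forall z, U z -> TU T f z = g z.
Proof.
move=> inj loc.
have /choice[Vf VfP] : forall z, exists Vf : set R[i]^o * (R[i]^o -> H), U z ->
   [/\ open Vf.1, Vf.1 `<=` U, Vf.1 z, analytic_on Vf.1 Vf.2 &
      forall w, Vf.1 w -> TU T Vf.2 w = g w].
  move=> z; have [Uz|nUz] := pselect (U z); last by exists (set0, fun=> 0).
  by have [V [Vo VU Vz [f fa fP]]] := loc z Uz; exists (V, f).
pose f z := (Vf z).2 z.
have ff z w : U z -> (Vf z).1 w -> f w = (Vf z).2 w.
  move=> Uz zw; have [Vo VU Vz Va VP] := VfP z Uz.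
  have Uw := VU w zw; have [Wo WU Ww Wa WP] := VfP w Uw.
  rewrite /f; apply: (inj ((Vf z).1 `&` (Vf w).1) _ _ (Vf w).2 (Vf z).2) => //.
  - exact: openI.
  - by move=> x [/VU].
  - by move=> x [_ ?]; apply: Wa.
  - by move=> x [? _]; apply: Va.
  - by move=> x [? ?]; rewrite WP// VP.
exists f; last first.
  by move=> z Uz; have [_ _ Vz _ VP] := VfP z Uz; rewrite /TU (ff z z)//; exact: VP.
apply/analyticP => z Uz; have [Vo VU Vz Va VP] := VfP z Uz.
have [d dP] := (analyticP _ _).1 Va z Vz.
have [dl dl0 dlP] := (open_modP _).1 Vo z Vz.
exists d; apply: has_deriv_near dl0 _ dP => w /dlP; exact: ff.
Qed.

Definition beta_on U := injective_TU T U /\ closed_range_TU T U.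

(** Property (beta) is local: injectivity obviously so, and then closedness of the
    range by gluing. *)
Lemma beta_local_global V :
  (forall z, V z -> bishop_beta_at T z) -> forall U, open U -> U `<=` V -> beta_on U.
Proof.
move=> bV.
have inj U : open U -> U `<=` V -> injective_TU T U.
  move=> Uo UV; apply/injective_TUP => f fa f0 z Uz.
  have [W [Wo Wz WP]] := bV z (UV z Uz).
  have [/injective_TUP inj _] := WP (W `&` U) (openI Wo Uo) (@subIsetl _ _ _).
  by apply: (inj f) => // w [_ Uw]; [exact: fa|exact: f0].
move=> U Uo UV; split; first exact: inj.
apply/closed_range_TUP => g ga gap; apply: glue_solutions.
  by move=> W Wo WU; apply: inj => //; exact: subset_trans WU UV.
move=> z Uz; have [W [Wo Wz WP]] := bV z (UV z Uz).
have [_ /closed_range_TUP cl] := WP (W `&` U) (openI Wo Uo) (@subIsetl _ _ _).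
exists (W `&` U); split=> //; first exact: openI.
apply: cl; first by move=> w [_ Uw]; exact: ga.
by apply: approximableS gap => w [].
Qed.

Lemma bishop_betaP : (forall z, bishop_beta_at T z) -> bishop_beta T.
Proof. by move=> b U Uo; apply: (@beta_local_global setT) => // z _; exact: b. Qed.

Lemma box_sub_open U z : open U -> U z -> exists2 r0 : R, 0 < r0 &
  forall r, 0 < r < r0 -> box z (3 * r) `<=` U.
Proof.
move=> /open_modP Uo /Uo[d d0 dP]; exists (d / 6); first by rewrite divr_gt0.
move=> r /andP[r0 rd] w [w1 w2]; apply: dP; apply: le_lt_trans (modulus_le_ReIm _) _.
by lra.
Qed.

(** Around each point of an open subset U of V there is a square inside U. It is
    compact, so g is a uniform limit on it of images of analytic functions under
    T_U, and local_solution provides a preimage of g near the point. *)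
Lemma bounded_below_around_beta V : open V ->
  (forall z, V z -> bounded_below_around T z) -> forall z, V z -> bishop_beta_at T z.
Proof.
move=> Vo ab z0 Vz0; exists V; split=> // U Uo UV.
have inj W : open W -> W `<=` V -> injective_TU T W.
  move=> Wo WV; apply/injective_TUP => f fa f0 z Wz.
  have [r1 r10 r1P] := ab z (WV z Wz); have [r2 r20 r2P] := box_sub_open Wo Wz.
  pose r := Num.min r1 r2 / 2.
  have m0 : 0 < Num.min r1 r2 by rewrite lt_min r10.
  have [rr1 rr2] : r < r1 /\ r < r2.
    by apply/andP; rewrite -lt_min /r; lra.
  have r0 : 0 < r by rewrite divr_gt0.
  have [c c0 cP] := r1P r ltac:(by rewrite r0).
  have rW := r2P r ltac:(by rewrite r0).
  apply: nm0_eq0; apply/eqP; rewrite eq_le nm_ge0 andbT.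
  have -> : 0 = 4 * 0 / c by rewrite mulr0 mul0r.
  apply: (interior_estimate r0 c0 cP (phi := f)).
  - by move=> w /rW; apply/(analyticP _ _).1.
  - by move=> w /rW/f0; rewrite /TU => ->; rewrite nm0.
  - by split; rewrite subrr /= normr0 ltW.
split; first exact: inj.
apply/closed_range_TUP => g ga gap; apply: glue_solutions.
  by move=> W Wo WU; apply: inj => //; exact: subset_trans WU UV.
move=> z Uz.
have [r1 r10 r1P] := ab z (UV z Uz); have [r2 r20 r2P] := box_sub_open Uo Uz.
pose r := Num.min r1 r2 / 2.
have m0 : 0 < Num.min r1 r2 by rewrite lt_min r10.
have [rr1 rr2] : r < r1 /\ r < r2.
  by apply/andP; rewrite -lt_min /r; lra.
have r0 : 0 < r by rewrite divr_gt0.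
have [c c0 cP] := r1P r ltac:(by rewrite r0).
have rU := r2P r ltac:(by rewrite r0).
have /choice[fs fsP] : forall n : nat, exists f, analytic_on U f /\
    forall w, box z (3 * r) w -> nm (TU T f w - g w) <= n.+1%:R^-1.
  move=> n; have [|f fa fP] := gap _ rU (@box_compact z (3 * r)) n.+1%:R^-1.
    by rewrite invr_gt0 ltr0n.
  by exists f; split=> // w /fP/ltW.
have [M M0 TM] := (linear_nmP (@linearP _ _ _ _ T)).1 T_cont.
have [||f fP] := @local_solution R H T M r c z g fs M0 TM r0 c0 cP.
  by move=> n w /rU; have [/analyticP fa _] := fsP n; exact: fa.
  by move=> n; have [_] := fsP n.
exists [set w | `|complex.Re (w - z)| < r /\ `|complex.Im (w - z)| < r]; split.
- apply/open_modP => w [w1 w2].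
  exists (Num.min (r - `|complex.Re (w - z)|) (r - `|complex.Im (w - z)|)).
    by rewrite lt_min !subr_gt0 w1.
  move=> y; rewrite lt_min => /andP[y1 y2].
  have tele (a b c' : R[i]) : a - c' = (b - c') + (a - b) by rewrite [RHS]addrC addrA subrK.
  split; rewrite (tele y w z) ?(ReD (w - z)) ?(ImD (w - z)); apply: le_lt_trans (ler_normD _ _) _.
    by apply: le_lt_trans (lerD (lexx _) (Re_le_modulus _)) _; rewrite -ltrBrDl.
  by apply: le_lt_trans (lerD (lexx _) (Im_le_modulus _)) _; rewrite -ltrBrDl.
- by move=> w [/ltW w1 /ltW w2]; apply: rU; exact: box3.
- by rewrite /= subrr /= normr0.
- exists f; first by apply/analyticP => w [w1 w2]; have [] := fP w w1 w2.
  by move=> w [w1 w2]; have [_] := fP w w1 w2.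
Qed.

End Closed.

End BishopEps.

(** * The shift is bounded below between the two radii *)

Section OrthonormalBasis.
Variables (R : realType) (H : completeNormedModType R[i]) (dot : {dot H for Num.conj}).
Hypothesis hdot : induces_norm dot.
Variable e : int -> H.
Hypothesis he : orthonormal_basis dot e.
Implicit Types (s t : seq int) (a b c : int -> R[i]) (x y : H).

Lemma pythagoras x y : dot x y = 0 -> nm (x + y) ^+ 2 = nm x ^+ 2 + nm y ^+ 2.
Proof.
move=> xy0; apply: complexI; rewrite rmorphD !rmorphXn /= -!nmE !hdot.
exact: hnormDd.
Qed.

Lemma nm_ortho_le x y : dot x y = 0 -> nm x <= nm (x + y).
Proof.
move=> /pythagoras xy; rewrite -(ler_pXn2r (n := 2))// ?nnegrE ?nm_ge0// xy lerDl.
by rewrite sqr_ge0.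
Qed.

Lemma dot_sum0 s t (P Q : pred int) a b (phi psi : int -> int) :
  (forall i j, P i -> Q j -> phi i != psi j) ->
  dot (\sum_(i <- s | P i) a i *: e (phi i)) (\sum_(j <- t | Q j) b j *: e (psi j)) = 0.
Proof.
move=> dis; rewrite linear_sumlz big1// => i Pi; rewrite linear_sumr big1// => j Qj.
by rewrite linearZlr /= (he.1) (negbTE (dis _ _ Pi Qj)) !mulr0.
Qed.

Lemma nm_e i : nm (e i) = 1.
Proof.
have : nm (e i) ^+ 2 = 1.
  by apply: complexI; rewrite rmorphXn /= -nmE hdot he.1 eqxx.
by move=> /eqP; rewrite sqrf_eq1 => /orP[/eqP//|/eqP h]; have := nm_ge0 (e i); lra.
Qed.

Lemma nm_sum_sqr s a (phi : int -> int) : injective phi -> uniq s ->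
  nm (\sum_(i <- s) a i *: e (phi i)) ^+ 2 = \sum_(i <- s) modulus (a i) ^+ 2.
Proof.
move=> phiI; elim: s => [|i s IH]; first by rewrite !big_nil nm0 expr0n.
move=> /= /andP[nis us]; rewrite !big_cons pythagoras; last first.
  have := @dot_sum0 [:: i] s (pred1 i) (mem s) a a phi phi.
  rewrite big_cons big_nil /= eqxx addr0 -big_seq; apply=> j k /eqP-> ks.
  by apply: contraNneq nis => /phiI->.
by rewrite IH// nmZ nm_e mulr1.
Qed.

(** Replacing basis vectors by other ones does not change norms, so two
    expansions can be compared coefficientwise after a relabelling. *)
Lemma nm_sum_le s a b (phi psi : int -> int) : injective phi -> injective psi -> uniq s ->
  (forall i, i \in s -> modulus (a i) <= modulus (b i)) ->
  nm (\sum_(i <- s) a i *: e (phi i)) <= nm (\sum_(i <- s) b i *: e (psi i)).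
Proof.
move=> phiI psiI us ab; rewrite -(ler_pXn2r (n := 2))// ?nnegrE ?nm_ge0// !nm_sum_sqr//.
rewrite big_seq [leRHS]big_seq; apply: ler_sum => i /ab.
by rewrite ler_pXn2r// nnegrE modulus_ge0.
Qed.

Lemma finite_sums_dense x (eps : R) : 0 < eps ->
  exists s c, uniq s /\ nm (\sum_(i <- s) c i *: e i - x) < eps.
Proof.
move=> eps0; have : closure [set x | exists (s : seq int) (c : int -> R[i]),
                     x = \sum_(i <- s) c i *: e i] x by rewrite he.2.
move=> /(_ [set y | nm (y - x) < eps])[|_ [[s [c ->]] /= sc]].
  by apply/nbhs_nmP; exists eps.
exists (undup s), (fun i => (count_mem i s)%:R * c i); split; first exact: undup_uniq.
move: sc; congr (nm (_ - _) < _); rewrite -[LHS]big_undup_iterop_count /=.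
apply: eq_bigr => i _; rewrite -scalerA scaler_nat.
by elim: (count_mem i s) => [|[|n] IH]//=; rewrite mulrS -IH.
Qed.

Lemma eq_continuous_linear (A B : H -> H) : linear A -> linear B ->
  continuous A -> continuous B -> (forall i, A (e i) = B (e i)) -> A =1 B.
Proof.
move=> Al Bl /(linear_nmP Al)[M M0 AM] /(linear_nmP Bl)[M' M'0 BM] AB x.
pose A' : {linear H -> H} := HB.pack A (GRing.isLinear.Build _ _ _ _ A Al).
pose B' : {linear H -> H} := HB.pack B (GRing.isLinear.Build _ _ _ _ B Bl).
apply/eqP; rewrite -subr_eq0; apply/eqP/nm0_eq0/eqP; rewrite eq_le nm_ge0 andbT.
apply/ler_addgt0Pr => eps eps0; rewrite add0r.
have eps1 : 0 < eps / (M + M') by rewrite divr_gt0// addr_gt0.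
have [s [c [_ sc]]] := finite_sums_dense x eps1.
have A'B' : A' (\sum_(i <- s) c i *: e i) = B' (\sum_(i <- s) c i *: e i).
  by rewrite !linear_sum; apply: eq_bigr => i _; rewrite !linearZ; congr (_ *: _); exact: AB.
have -> : A x - B x = B' (\sum_(i <- s) c i *: e i - x) - A' (\sum_(i <- s) c i *: e i - x).
  by rewrite (linearB B') (linearB A') A'B' opprB [RHS]addrC addrA subrK.
apply: le_trans (nmB _ _) _; apply: le_trans (lerD (BM _) (AM _)) _.
rewrite -mulrDl mulrC -ler_pdivlMr ?addr_gt0// (addrC M').
exact: ltW.
Qed.

Section Shift.
Variables (w : int -> R) (S : {linear H -> H}).
Hypothesis w_gt0 : forall n, 0 < w n.
Hypothesis S_cont : continuous S.
Hypothesis S_shift : forall n, S (e n) = (w n)%:C *: e (n + 1).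

(** The weights of the N-th power of the shift, see iter_shift. *)
Definition weight_prod (N : nat) (j : int) : R := \prod_(i < N) w (j + i%:Z).

Lemma weight_prod_gt0 N j : 0 < weight_prod N j.
Proof. by apply: prodr_gt0 => i _; exact: w_gt0. Qed.

Lemma iter_shift N j : iter N S (e j) = (weight_prod N j)%:C *: e (j + N%:Z).
Proof.
elim: N => [|N IH]; first by rewrite /weight_prod big_ord0 scale1r addr0.
rewrite iterS IH linearZ /= S_shift scalerA -rmorphM /weight_prod big_ord_recr /=.
by rewrite -addrA (addrC N%:Z) -intS.
Qed.

Lemma iter_shift_sum N s (P : pred int) c : iter N S (\sum_(i <- s | P i) c i *: e i) =
  \sum_(i <- s | P i) (c i * (weight_prod N i)%:C) *: e (i + N%:Z).
Proof.
have itl : forall n : nat, linear (iter n S).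
  by elim=> [|n IH] k x y //; rewrite !iterS IH linearP.
pose T : {linear H -> H} := HB.pack (iter N S) (GRing.isLinear.Build _ _ _ _ (iter N S) (itl N)).
rewrite -[LHS]/(T _) linear_sum; apply: eq_bigr => i _.
by rewrite linearZ /= iter_shift scalerA.
Qed.

(** Split x = xp + xn at index 0. The part of y = S^N x - mu x with indices >= N is
    S^N xp - mu (tail of xp), of norm at least (k - m2) |xp|, because S^N expands
    xp by k; the part with indices < 0 is S^N (tail of xn) - mu xn, of norm at
    least (m1 - d) |xn|, because S^N contracts that tail by d. By orthogonality
    each part is at most y in norm. The indices from - N to -1, where the
    weights of S^N are not controlled, are shifted out of both parts. *)
Lemma iter_bounded_below_sum N (k d m1 m2 : R) (mu : R[i]) s c :
  (forall j, 0 <= j -> k <= weight_prod N j) ->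
  (forall j, j < - N%:Z -> weight_prod N j <= d) ->
  d < m1 -> m2 < k -> m1 <= modulus mu <= m2 -> uniq s ->
  forall x, x = \sum_(i <- s) c i *: e i ->
  nm x <= ((k - m2)^-1 + (m1 - d)^-1) * nm (iter N S x - mu *: x).
Proof.
move=> kP dP dm1 m2k /andP[mu1 mu2] us x xE; set y := iter N S x - _.
pose X (P : pred int) := \sum_(i <- s | P i) c i *: e i.
have addI : injective (fun i : int => i + N%:Z) by move=> i j /addIr.
have muX P : mu *: X P = \sum_(i <- s | P i) (mu * c i) *: e i.
  by rewrite scaler_sumr; apply: eq_bigr => i _; rewrite scalerA.
have split_x (P : pred int) : x = X P + X (predC P) by rewrite xE (bigID P).
have itX (P : pred int) : iter N S x = iter N S (X P) + iter N S (X (predC P)).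
  by rewrite {1}xE !iter_shift_sum (bigID P).
have sub (P Q : pred int) : (forall i, P i -> Q i) -> nm (X P) <= nm (X Q).
  move=> PQ; rewrite [X in _ <= nm X](bigID P) /=.
  rewrite (eq_bigl P); last by move=> i; rewrite andb_idl//; exact: PQ.
  apply: nm_ortho_le; apply: (@dot_sum0 s s P _ _ _ id id) => i j Pi /andP[_].
  by apply: contraNneq => <-.
have ortho (P1 Q1 P2 Q2 : pred int) :
    (forall i j, P1 i -> P2 j -> i != j) ->
    (forall i j, P1 i -> Q2 j -> i + N%:Z != j) ->
    (forall i j, Q1 i -> P2 j -> i != j + N%:Z) ->
    (forall i j, Q1 i -> Q2 j -> i != j) ->
    nm (iter N S (X P1) - mu *: X Q1) <=
      nm ((iter N S (X P1) - mu *: X Q1) + (iter N S (X P2) - mu *: X Q2)).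
  move=> d1 d2 d3 d4; apply: nm_ortho_le; rewrite !iter_shift_sum !muX.
  set A1 := (X in X - _); set B1 := (X in _ - X).
  set A2 := (X in dot _ (X - _)); set B2 := (X in dot _ (_ - X)).
  have AA : dot A1 A2 = 0.
    apply: (@dot_sum0 s s P1 P2 _ _ (fun i => i + N%:Z) (fun i => i + N%:Z)) => i j /d1 + P2j.
    by move=> /(_ _ P2j); apply: contraNneq => /addI->.
  have AB : dot A1 B2 = 0 by exact: (@dot_sum0 s s P1 Q2 _ _ (fun i => i + N%:Z) id).
  have BA : dot B1 A2 = 0 by exact: (@dot_sum0 s s Q1 P2 _ _ id (fun i => i + N%:Z)).
  have BB : dot B1 B2 = 0 by exact: (@dot_sum0 s s Q1 Q2 _ _ id id).
  by rewrite linearBl !linearBr /= AA AB BA BB !subrr.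
have yE (P Q : pred int) : y = (iter N S (X P) - mu *: X Q)
    + (iter N S (X (predC P)) - mu *: X (predC Q)).
  by rewrite addrACA -itX -opprD -scalerDr -split_x.
have d0 : 0 < d.
  apply: lt_le_trans (dP (- N%:Z - 1) _); first exact: weight_prod_gt0.
  by rewrite gtrDl.
have hp : (k - m2) * nm (X (fun i => 0 <= i)) <= nm y.
  rewrite (yE (fun i => 0 <= i) (fun i => N%:Z <= i)).
  apply: le_trans (ortho _ _ _ _ _ _ _ _); try (move=> i j /=; clear; lia).
  have h1 : k * nm (X (fun i => 0 <= i)) <= nm (iter N S (X (fun i => 0 <= i))).
    have k0 : 0 <= k by have := modulus_ge0 mu; lra.
    have kE (v : H) : k * nm v = nm (k%:C *: v) by rewrite nmZ modulus_real ger0_norm.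
    rewrite kE /X iter_shift_sum -!(big_filter _ (fun i => 0 <= i)) scaler_sumr.
    under [X in nm X <= _]eq_bigr do rewrite scalerA.
    apply: (nm_sum_le (phi := id) (psi := fun i => i + N%:Z)) => //.
      by rewrite filter_uniq.
    move=> i; rewrite mem_filter => /andP[i0 _]; rewrite mulrC !modulusM !modulus_real.
    rewrite ler_wpM2l ?modulus_ge0// !ger0_norm ?kP//; exact/ltW/weight_prod_gt0.
  have h2 : nm (mu *: X (fun i => N%:Z <= i)) <= m2 * nm (X (fun i => 0 <= i)).
    rewrite nmZ ler_pM ?modulus_ge0 ?nm_ge0//; apply: sub => i; clear; lia.
  have h3 := nmD (iter N S (X (fun i => 0 <= i)) - mu *: X (fun i => N%:Z <= i)) (mu *: X (fun i => N%:Z <= i)).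
  by rewrite subrK in h3; lra.
have hn : (m1 - d) * nm (X (fun i => i < 0)) <= nm y.
  rewrite (yE (fun i => i < - N%:Z) (fun i => i < 0)).
  apply: le_trans (ortho _ _ _ _ _ _ _ _); try (move=> i j /=; clear; lia).
  have h1 : nm (iter N S (X (fun i => i < - N%:Z))) <= d * nm (X (fun i => i < - N%:Z)).
    have dE (v : H) : d * nm v = nm (d%:C *: v) by rewrite nmZ modulus_real gtr0_norm.
    rewrite dE /X iter_shift_sum -!(big_filter _ (fun i => i < - N%:Z)) scaler_sumr.
    under [X in _ <= nm X]eq_bigr do rewrite scalerA.
    apply: (nm_sum_le (psi := id) (phi := fun i => i + N%:Z)) => //.
      by rewrite filter_uniq.
    move=> i; rewrite mem_filter => /andP[i0 _]; rewrite mulrC !modulusM !modulus_real.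
    rewrite ler_wpM2r ?modulus_ge0// !gtr0_norm ?dP//; exact: weight_prod_gt0.
  have h2 : d * nm (X (fun i => i < - N%:Z)) <= d * nm (X (fun i => i < 0)).
    by rewrite ler_pM2l//; apply: sub => i; clear; lia.
  have h3 : m1 * nm (X (fun i => i < 0)) <= nm (mu *: X (fun i => i < 0)).
    by rewrite nmZ ler_wpM2r// nm_ge0.
  have h4 := nmB (iter N S (X (fun i => i < - N%:Z)))
     (iter N S (X (fun i => i < - N%:Z)) - mu *: X (fun i => i < 0)).
  by rewrite subKr in h4; lra.
have -> : x = X (fun i => 0 <= i) + X (fun i => i < 0).
  rewrite (split_x (fun i => 0 <= i)); congr (_ + _).
  by apply: eq_bigl => i /=; rewrite ltNge.
apply: le_trans (nmD _ _) _; rewrite mulrDl; apply: lerD.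
  by rewrite ler_pdivlMl ?subr_gt0.
by rewrite ler_pdivlMl ?subr_gt0.
Qed.

(** S^N - l^N factors through S - l, with a bound uniform in l. *)
Lemma iter_factor (M r2 : R) N : 0 < M -> (forall x, nm (S x) <= M * nm x) -> 0 <= r2 ->
  exists2 C, 0 <= C & forall (l : R[i]) x, modulus l <= r2 ->
    nm (iter N S x - l ^+ N *: x) <= C * nm (S x - l *: x).
Proof.
move=> M0 SM r20; elim: N => [|N [C C0 IH]].
  by exists 0 => // l x _; rewrite expr0 scale1r subrr nm0 mul0r.
exists (M * C + r2 ^+ N); first by rewrite addr_ge0 ?exprn_ge0// mulr_ge0// ltW.
move=> l x lr.
have -> : iter N.+1 S x - l ^+ N.+1 *: x =
    S (iter N S x - l ^+ N *: x) + l ^+ N *: (S x - l *: x).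
  have SZ : S (l ^+ N *: x) = l ^+ N *: S x by exact: linearZ.
  by rewrite linearB SZ scalerBr scalerA -exprSr addrA subrK.
apply: le_trans (nmD _ _) _; rewrite mulrDl; apply: lerD.
  by apply: le_trans (SM _) _; rewrite -mulrA ler_pM2l// IH.
by rewrite nmZ ler_wpM2r ?nm_ge0// modulusX lerXn2r// ?nnegrE ?modulus_ge0.
Qed.

(** The preceding bound applies to S^N with mu = l^N, and passes to S - l by the
    factorisation and to all vectors by density. *)
Lemma shift_bounded_below N (k d r1 r2 : R) :
  (forall j, 0 <= j -> k <= weight_prod N j) ->
  (forall j, j < - N%:Z -> weight_prod N j <= d) ->
  0 <= r1 -> 0 <= r2 -> d < r1 ^+ N -> r2 ^+ N < k ->
  exists2 c, 0 < c & forall l : R[i], r1 <= modulus l <= r2 -> bounded_below_by S c l.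
Proof.
move=> kP dP r10 r20 dr1 r2k.
have [M M0 SM] := (linear_nmP (@linearP _ _ _ _ S)).1 S_cont.
have [C C0 CP] := iter_factor N M0 SM r20.
pose K := (k - r2 ^+ N)^-1 + (r1 ^+ N - d)^-1.
have K0 : 0 < K by rewrite addr_gt0// invr_gt0 subr_gt0.
exists (K * (C + 1))^-1; first by rewrite invr_gt0 mulr_gt0//; lra.
move=> l /andP[l1 l2] x; rewrite ler_pdivrMl; last by rewrite mulr_gt0//; lra.
have fin s c : uniq s -> nm (\sum_(i <- s) c i *: e i) <=
    K * C * nm (S (\sum_(i <- s) c i *: e i) - l *: (\sum_(i <- s) c i *: e i)).
  move=> us.
  have lN : r1 ^+ N <= modulus (l ^+ N) <= r2 ^+ N.
    by rewrite modulusX !lerXn2r// ?nnegrE ?modulus_ge0.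
  have := iter_bounded_below_sum kP dP dr1 r2k lN us (erefl (\sum_(i <- s) c i *: e i)).
  move=> /le_trans; apply; rewrite -/K.
  by rewrite -mulrA ler_pM2l// CP.
apply/ler_addgt0Pr => eps eps0.
pose D := 1 + K * C * (M + modulus l).
have D0 : 0 < D.
  have : 0 <= K * C * (M + modulus l).
    apply: mulr_ge0; first by apply: mulr_ge0 => //; exact: ltW.
    by apply: addr_ge0; [exact: ltW|exact: modulus_ge0].
  by rewrite /D; lra.
have eps1 : 0 < eps / D by rewrite divr_gt0.
have [s [c [us sc]]] := finite_sums_dense x eps1.
have := fin s c us; set y := \sum_(i <- s) _ in sc * => h1.
have h2 : nm (S y - l *: y) <= nm (S x - l *: x) + (M + modulus l) * (eps / D).
  have -> : S y - l *: y = (S x - l *: x) + (S (y - x) - l *: (y - x)).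
    have SB : S (y - x) = S y - S x by exact: linearB.
    rewrite SB scalerBr !opprD !opprK !addrA [RHS](ACl (3*5*(1*4)*(2*6))) /=.
    by rewrite subrr addNr !addr0.
  apply: le_trans (nmD _ _) _; rewrite lerD2l; apply: le_trans (nmB _ _) _.
  rewrite mulrDl lerD//; last by rewrite nmZ ler_wpM2l ?modulus_ge0// ltW.
  by apply: le_trans (SM _) _; rewrite ler_pM2l// ltW.
have h3 : nm x <= nm y + eps / D.
  have := nmtri x y 0; rewrite !subr0 => /le_trans; apply.
  by rewrite addrC lerD2l nmC ltW.
have -> : eps = (eps / D) + K * C * ((M + modulus l) * (eps / D)).
  by rewrite [in LHS](_ : eps = D * (eps / D)) {1}/D; [ring|rewrite mulrC divfK// gt_eqF].
have h4 : K * C * nm (S y - l *: y) <= K * C * (nm (S x - l *: x) + (M + modulus l) * (eps / D)).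
  by rewrite ler_wpM2l// mulr_ge0// ltW.
have h5 : K * C * nm (S x - l *: x) <= K * (C + 1) * nm (S x - l *: x).
  by rewrite ler_wpM2r ?nm_ge0// ler_pM2l//; lra.
lra.
Qed.

End Shift.
End OrthonormalBasis.

(** * The radii control products of weights *)

Section Roots.
Variable R : realType.
Implicit Types (a : nat -> R) (x y t : R).

Definition nroot n x := x `^ n%:R^-1.

Lemma nrootK n x : (0 < n)%N -> 0 <= x -> nroot n x ^+ n = x.
Proof.
move=> n0 x0; rewrite -powR_mulrn ?powR_ge0// -powRrM mulVf ?powRr1//.
by rewrite pnatr_eq0 -lt0n.
Qed.

Lemma nroot_lt n x y : (0 < n)%N -> 0 <= x -> 0 <= y -> (nroot n x < y) = (x < y ^+ n).
Proof.
by move=> n0 x0 y0; rewrite -{2}(nrootK n0 x0) ltr_pXn2r// nnegrE powR_ge0.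
Qed.

Lemma lt_nroot n x y : (0 < n)%N -> 0 <= x -> 0 <= y -> (y < nroot n x) = (y ^+ n < x).
Proof.
by move=> n0 x0 y0; rewrite -{2}(nrootK n0 x0) ltr_pXn2r// nnegrE powR_ge0.
Qed.

Section Fekete.
Variable a : nat -> R.
Hypothesis a_ge0 : forall n, 0 <= a n.
Hypothesis a_submul : forall m n, a (m + n)%N <= a m * a n.

(** Write n = q m + s with s < m. Then a n <= (a m) ^ q * a s, and
    (a m / t ^ m) ^ q tends to 0 while a s / t ^ s takes finitely many values. *)
Lemma submul_lt m t : (0 < m)%N -> 0 < t -> a m < t ^+ m ->
  exists n0, forall n, (n0 <= n)%N -> a n < t ^+ n.
Proof.
move=> m0 t0 amt; have tn n : 0 < t ^+ n by exact: exprn_gt0.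
pose th := a m / t ^+ m; have th0 : 0 <= th by rewrite divr_ge0// ltW.
have th1 : th < 1 by rewrite ltr_pdivrMr// mul1r.
pose C := \sum_(s < m) a s / t ^+ s + 1.
have C0 : 0 < C by rewrite ltr_wpDl// sumr_ge0// => s _; rewrite divr_ge0// ltW.
have aC s : (s < m)%N -> a s <= C * t ^+ s.
  move=> sm; rewrite -ler_pdivrMr// /C (bigD1 (Ordinal sm)) //= -addrA lerDl.
  by rewrite addr_ge0// sumr_ge0// => i _; rewrite divr_ge0// ltW.
have aq q s : a (q * m + s)%N <= a m ^+ q * a s.
  elim: q => [|q IH]; first by rewrite mul0n expr0 mul1r.
  rewrite mulSn -addnA exprS -mulrA; apply: le_trans (a_submul _ _) _.
  by rewrite ler_wpM2l.
have [q0 _ q0P] : \forall q \near \oo, th ^+ q < C^-1.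
  have : (fun q => th ^+ q) @ \oo --> (0 : R) by apply: cvg_expr; rewrite ger0_norm.
  move=> /cvgrPdist_lt/(_ C^-1); rewrite invr_gt0 => /(_ C0).
  by apply: filterS => q; rewrite sub0r normrN ger0_norm ?exprn_ge0.
exists (q0 * m)%N => n nq; rewrite (divn_eq n m).
set q := (n %/ m)%N; set s := (n %% m)%N.
have sm : (s < m)%N by rewrite ltn_mod.
have qq : (q0 <= q)%N by rewrite leq_divRL.
apply: le_lt_trans (aq q s) _.
have am : a m = th * t ^+ m by rewrite divfK// gt_eqF.
apply: (@le_lt_trans _ _ (a m ^+ q * (C * t ^+ s))).
  by rewrite ler_wpM2l ?exprn_ge0// aC.
rewrite am exprMn -exprM (mulnC m) exprD mulrACA gtr_pMl ?mulr_gt0//.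
by rewrite -ltr_pdivlMr// mul1r; exact: q0P.
Qed.

(** The limit is the infimum over n > 0, by the previous lemma. *)
Lemma fekete : cvgn (fun n => nroot n (a n)).
Proof.
pose E := [set nroot n (a n) | n in [set n | (0 < n)%N]].
have Elb : lbound E 0 by move=> _ [n _ <-]; exact: powR_ge0.
have E0 : E !=set0 by exists (nroot 1 (a 1%N)), 1%N.
apply/cvg_ex; exists (inf E); apply/cvgrPdist_lt => e e0.
have infE : 0 <= inf E by apply: lb_le_inf.
have [_ [m /= m0 <-] mP] : exists2 x, E x & x < inf E + e.
  by apply: inf_adherent => //; split=> //; exists 0.
have [n0 n0P] : exists n0, forall n, (n0 <= n)%N -> a n < (inf E + e) ^+ n.
  apply: (@submul_lt m) => //; first by rewrite ltr_wpDl.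
  by rewrite -nroot_lt// addr_ge0// ltW.
exists (maxn 1 n0) => // n /=; rewrite geq_max => /andP[n1 /n0P an].
have h1 : inf E <= nroot n (a n) by apply: ge_inf; [exists 0|exists n].
have h2 : nroot n (a n) < inf E + e by rewrite nroot_lt// addr_ge0// ltW.
by rewrite ltr_norml; apply/andP; split; lra.
Qed.

End Fekete.
End Roots.

Section Rates.
Variables (R : realType) (w : int -> R).
Hypotheses (w_gt0 : forall n, 0 < w n) (w_bnd : bounded_fun w).

Lemma shift_beta_gt0 n : 0 < shift_beta w n.
Proof.
case: n => n; rewrite /shift_beta ?invr_gt0; apply: prodr_gt0 => i _; exact: w_gt0.
Qed.

Lemma shift_betaS n : shift_beta w (n + 1) = w n * shift_beta w n.
Proof.
case: n => [n|[|n]].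
- by rewrite -PoszD addn1 /shift_beta big_ord_recr /= mulrC.
- by rewrite NegzE addNr /shift_beta /= big_ord0 big_ord1 mulfV// gt_eqF.
- have -> : Negz n.+1 + 1 = Negz n by rewrite !NegzE; lia.
  rewrite /shift_beta [in RHS]big_ord_recr /= NegzE invfM mulrCA mulfV ?mulr1//.
  by rewrite gt_eqF.
Qed.

Lemma shift_beta_ratio N j : shift_beta w (j + N%:Z) / shift_beta w j = weight_prod w N j.
Proof.
elim: N => [|N IH].
  by rewrite addr0 mulfV ?gt_eqF ?shift_beta_gt0// /weight_prod big_ord0.
rewrite /weight_prod big_ord_recr /= -/(weight_prod w N j) -IH.
by rewrite intS (addrC 1) addrA shift_betaS -mulrA mulrC.
Qed.

Lemma weight_prodD m n j : weight_prod w (m + n) j = weight_prod w m j * weight_prod w n (j + m%:Z).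
Proof.
rewrite -!shift_beta_ratio PoszD addrA [RHS]mulrC mulrA divfK// gt_eqF//; exact: shift_beta_gt0.
Qed.

Lemma weight_bound : exists2 M : R, 0 < M & forall N j, weight_prod w N j <= M ^+ N.
Proof.
have [M M0 MP] := pinfty_ex_gt0 w_bnd.
exists M => // N j; rewrite -[N in M ^+ N]card_ord -prodr_const; apply: ler_prod => i _.
by rewrite ltW//= (le_trans (ler_norm _))// MP.
Qed.

Let back n := sup [set shift_beta w (- k%:Z) / shift_beta w (- n%:Z - k%:Z)
         | k in [set k : nat | (0 < k)%N]].

Lemma back_ratio n (k : nat) :
  shift_beta w (- k%:Z) / shift_beta w (- n%:Z - k%:Z) = weight_prod w n (- n%:Z - k%:Z).
Proof. by rewrite -shift_beta_ratio; congr (shift_beta _ _ / _); ring. Qed.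

Lemma weight_prod_back n j : j < - n%:Z -> weight_prod w n j <= back n.
Proof.
move=> jn; have [M M0 MP] := weight_bound.
apply: ub_le_sup; first by exists (M ^+ n) => _ [k _ <-]; rewrite back_ratio.
exists (absz (- n%:Z - j)); first by rewrite /=; lia.
by rewrite back_ratio; congr weight_prod; lia.
Qed.

Lemma back_ge0 n : 0 <= back n.
Proof.
apply: le_trans (@weight_prod_back n (- n%:Z - 1) _); last by lia.
exact/ltW/weight_prod_gt0.
Qed.

Lemma back_submul m n : back (m + n) <= back m * back n.
Proof.
apply: ge_sup; first by eexists; exists 1%N.
move=> _ [k /= k0 <-]; rewrite back_ratio weight_prodD.
by apply: ler_pM; rewrite ?(ltW (weight_prod_gt0 _ _ _))//; apply: weight_prod_back; lia.
Qed.

(** The limit defining rminus exists by Fekete's lemma. *)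
Lemma rminus_lt (r : R) : 0 <= r -> rminus w < r -> exists n0, forall n, (n0 <= n)%N ->
  exists2 d, d < r ^+ n & forall j, j < - n%:Z -> weight_prod w n j <= d.
Proof.
move=> r0 wr; have cv : (fun n => nroot n (back n)) @ \oo --> rminus w := fekete back_ge0 back_submul.
have [n0 _ n0P] := cvgr_lt _ cv _ wr.
exists (maxn 1 n0) => n; rewrite geq_max => /andP[n1 /n0P /= nb].
exists (back n); last exact: weight_prod_back.
by rewrite -nroot_lt// back_ge0.
Qed.

(** The value of a divergent limit is 0 by convention, so a radius larger than
    r >= 0 comes from a convergent sequence. *)
Lemma r1plus_gt (r : R) : 0 <= r -> r < r1plus w -> exists n0, forall n, (n0 <= n)%N ->
  exists2 k, r ^+ n < k & forall j, 0 <= j -> k <= weight_prod w n j.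
Proof.
move=> r0 rw; pose fwd n := inf (range (fun k : nat => shift_beta w (n%:Z + k%:Z) / shift_beta w k%:Z)).
have cv : (fun n => nroot n (fwd n)) @ \oo --> r1plus w.
  apply: cvgNpoint; rewrite gt_eqF//; exact: le_lt_trans r0 rw.
have fr n (k : nat) : shift_beta w (n%:Z + k%:Z) / shift_beta w k%:Z = weight_prod w n k%:Z.
  by rewrite (addrC n%:Z) shift_beta_ratio.
have flb n : lbound (range (fun k : nat => shift_beta w (n%:Z + k%:Z) / shift_beta w k%:Z)) 0.
  by move=> _ [k _ <-]; rewrite fr ltW ?weight_prod_gt0.
have [n0 _ n0P] := cvgr_gt _ cv _ rw.
exists (maxn 1 n0) => n; rewrite geq_max => /andP[n1 /n0P /= nb].
exists (fwd n).
  rewrite -lt_nroot//; apply: lb_le_inf => //.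
  by eexists; exists 0%N.
move=> [k|k] // _; apply: ge_inf; first by exists 0.
by exists k => //; rewrite fr.
Qed.

End Rates.

(** * Spectrum and bounds below *)

Section Spectrum.
Variables (R : realType) (H : completeNormedModType R[i]).
Implicit Types (x y : H) (z l : R[i]).

Section Operator.
Variable T : {linear H -> H}.
Hypothesis T_cont : continuous T.

Lemma linear_shifted z : linear (fun x => T x - z *: x).
Proof.
move=> a x y; rewrite linearP scalerDr scalerA mulrC -scalerA scalerBr.
by rewrite opprD addrACA.
Qed.

Lemma bounded_below_invertible z : bounded_below_at T z ->
  (forall y, exists x, T x - z *: x = y) -> invertible (fun x => T x - z *: x).
Proof.
move=> [c c0 cP] /choice[A AP]; exists A.
have inj x y : T x - z *: x = T y - z *: y -> x = y.
  move=> /eqP; rewrite -subr_eq0 => /eqP xy; apply/eqP; rewrite -subr_eq0; apply/eqP/nm0_eq0.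
  have := cP (x - y); have -> : T (x - y) - z *: (x - y) = 0.
    have TB : T (x - y) = T x - T y by exact: linearB.
    rewrite -xy TB scalerBr !opprD !opprK !addrA.
    by rewrite [RHS](ACl (1*3*2*4)).
  by rewrite nm0 pmulr_rle0// => h; apply/eqP; rewrite eq_le h nm_ge0.
have Al : linear A.
  by move=> a x y; apply: inj; rewrite (linear_shifted z a) !AP.
split=> //; last by move=> x; exact: inj.
apply/(linear_nmP Al); exists c^-1; first by rewrite invr_gt0.
by move=> x; rewrite ler_pdivlMl//; have := cP (A x); rewrite AP.
Qed.

Lemma invertible_bounded_below z : invertible (fun x => T x - z *: x) -> bounded_below_at T z.
Proof.
move=> [A [Al Ac AK _]]; have [M M0 AM] := (linear_nmP Al).1 Ac.
exists M^-1; first by rewrite invr_gt0.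
by move=> x; rewrite ler_pdivrMl//; have := AM (T x - z *: x); rewrite AK.
Qed.

(** The equation reads x = (T x - y) / z, and the right-hand side contracts by
    the factor th = M / |z| < 1; u is the sequence of Picard iterates from 0. *)
Lemma solvable_large (M : R) z y : 0 < M -> (forall x, nm (T x) <= M * nm x) -> M < modulus z ->
  exists x, T x - z *: x = y.
Proof.
move=> M0 TM Mz; have z0 : z != 0 by rewrite -modulus_gt0; exact: lt_trans Mz.
have mz : 0 < modulus z by rewrite modulus_gt0.
pose u n := iter n (fun x => z^-1 *: (T x - y)) 0.
have uS n : z *: u n.+1 = T (u n) - y by rewrite /u iterS scalerA mulfV// scale1r.
pose th := M / modulus z.
have th0 : 0 < th by rewrite divr_gt0.
have th1 : th < 1 by rewrite ltr_pdivrMr// mul1r.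
pose D := nm (u 1%N).
have step n : nm (u n.+1 - u n) <= D * th ^+ n.
  elim: n => [|n IH]; first by rewrite subr0 mulr1.
  rewrite -(ler_pM2l mz) -nmZ scalerBr !uS opprB addrA subrK -linearB.
  apply: le_trans (TM _) _.
  have -> : modulus z * (D * th ^+ n.+1) = M * (D * th ^+ n).
    by rewrite exprS /th; field; rewrite gt_eqF.
  by rewrite ler_pM2l.
have D0 : 0 <= D by exact: nm_ge0.
pose C := D / (1 - th).
have th1' : 0 < 1 - th by rewrite subr_gt0.
have C0 : 0 <= C by rewrite divr_ge0// ltW.
have far n k : nm (u (n + k)%N - u n) <= C * th ^+ n * (1 - th ^+ k).
  elim: k => [|k IH]; first by rewrite addn0 subrr nm0 expr0 subrr mulr0.
  apply: le_trans (nmtri _ (u (n + k)%N) _) _; rewrite addnS.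
  apply: le_trans (lerD (step _) IH) _; rewrite le_eqVlt; apply/orP; left; apply/eqP.
  by rewrite exprD exprS /C; field; rewrite gt_eqF.
have thc : (fun n => th ^+ n) @ \oo --> (0 : R) by apply: cvg_expr; rewrite gtr0_norm.
have small (e : R) : 0 < e -> exists n0, forall n, (n0 <= n)%N -> C * th ^+ n < e.
  move=> e0; have e1 : 0 < e / (C + 1) by rewrite divr_gt0//; lra.
  have [n0 _ n0P] := (cvgrPdist_lt _ _).1 thc _ e1.
  exists n0 => n /n0P; rewrite /= sub0r normrN ger0_norm; last by rewrite exprn_ge0// ltW.
  rewrite ltr_pdivlMr; last lra.
  have : 0 < th ^+ n by rewrite exprn_gt0.
  by rewrite mulrDr mulr1 mulrC; lra.
have far' n k : nm (u (n + k)%N - u n) <= C * th ^+ n.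
  apply: le_trans (far n k) _; rewrite ler_piMr//; first by rewrite mulr_ge0// exprn_ge0// ltW.
  by rewrite gerBl exprn_ge0// ltW.
have [|l ul] := @cauchy_nm R H u.
  move=> e /small[n0 n0P]; exists n0 => m n mn nn; wlog nm : m n mn nn / (n <= m)%N.
    by move=> W; have [/W|/ltnW/W] := leqP n m; [apply|rewrite nmC; apply].
  by rewrite -(subnKC nm); apply: le_lt_trans (far' _ _) (n0P _ nn).
exists l; apply/eqP; rewrite -subr_eq0; apply/eqP/nm0_eq0/eqP; rewrite eq_le nm_ge0 andbT.
apply/ler_addgt0Pr => e e0; rewrite add0r.
have e1 : 0 < e / (M + modulus z) by rewrite divr_gt0// addr_gt0.
have [n0 n0P] := (cvgn_nmP _ _).1 ul _ e1.
have h1 := n0P n0 (leqnn _); have h2 := n0P n0.+1 (leqnSn _).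
have -> : T l - z *: l - y = z *: (u n0.+1 - l) - T (u n0 - l).
  have TB : T (u n0 - l) = T (u n0) - T l by exact: linearB.
  rewrite TB scalerBr uS !opprD !opprK !addrA [RHS](ACl (5*3*2*(1*4))) /=.
  by rewrite subrr addr0.
apply: le_trans (nmB _ _) _; rewrite nmZ.
apply: le_trans (lerD (ler_wpM2l (modulus_ge0 z) (ltW h2)) (le_trans (TM _) (ler_wpM2l (ltW M0) (ltW h1)))) _.
rewrite le_eqVlt; apply/orP; left; apply/eqP; field; rewrite gt_eqF// addr_gt0//.
Qed.

Lemma bounded_below_large (M : R) z : (forall x, nm (T x) <= M * nm x) -> M < modulus z ->
  bounded_below_at T z.
Proof.
move=> TM Mz; exists (modulus z - M); first by rewrite subr_gt0.
move=> x; have := nmB (T x) (T x - z *: x); rewrite subKr nmZ.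
by have := TM x; lra.
Qed.

(** This is what makes the supremum defining the spectral radius an upper bound. *)
Lemma spectrum_bounded : exists M : R, forall z, spectrum T z -> modulus z <= M.
Proof.
have [M M0 TM] := (linear_nmP (@linearP _ _ _ _ T)).1 T_cont.
exists M => z; apply: contra_notT; rewrite -ltNge => Mz.
apply: bounded_below_invertible; first exact: bounded_below_large TM Mz.
by move=> y; exact: solvable_large Mz.
Qed.

Lemma bounded_below_gt_radius z : spectral_radius T < modulus z -> bounded_below_at T z.
Proof.
move=> Tz; apply: invertible_bounded_below; apply: contrapT => zT.
have [M MP] := spectrum_bounded.
suff : modulus z <= spectral_radius T by rewrite leNgt Tz.
by apply: ub_le_sup; [exists M => _ [l /MP ? <-]|exists z].
Qed.

Lemma bounded_below_lt_min z : modulus z < spectral_min T -> bounded_below_at T z.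
Proof.
move=> Tz; apply: invertible_bounded_below; apply: contrapT => zT.
suff : spectral_min T <= modulus z by rewrite leNgt Tz.
by apply: ge_inf; [exists 0 => _ [l _ <-]; exact: modulus_ge0|exists z].
Qed.

End Operator.

(** From A - 1/z = - (1/z) A (T - z), the inverse is - z (T - z)^-1 T. *)
Lemma shifted_inverse (T A : {linear H -> H}) z : continuous T -> cancel T A -> cancel A T ->
  z != 0 -> invertible (fun x => T x - z *: x) -> invertible (fun x => A x - z^-1 *: x).
Proof.
move=> Tc TA AT z0 [B [Bl Bc BK KB]].
pose B' : {linear H -> H} := HB.pack B (GRing.isLinear.Build _ _ _ _ B Bl).
have TB x : T (B x) = x + z *: B x.
  by apply/eqP; rewrite -subr_eq; apply/eqP; exact: KB.
have BT x : B (T x) = x + z *: B x.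
  have := BK x; rewrite -[B _]/(B' _) linearB linearZ => /eqP; rewrite subr_eq => /eqP.
  exact.
exists (fun x => - z *: B (T x)); split.
- move=> a x y /=; rewrite linearP -[B _]/(B' _) linearP scalerDr !scalerA.
  by rewrite (mulrC (- z)).
- have [M M0 BM] := (linear_nmP Bl).1 Bc.
  have [M' M'0 TM] := (linear_nmP (@linearP _ _ _ _ T)).1 Tc.
  apply/linear_nmP; first by move=> a x y /=; rewrite linearP -[B _]/(B' _) linearP scalerDr !scalerA (mulrC (- z)).
  exists (modulus z * (M * M')); first by rewrite !mulr_gt0// modulus_gt0.
  move=> x; rewrite nmZ modulusN -!mulrA ler_wpM2l ?modulus_ge0//.
  by apply: le_trans (BM _) _; rewrite ler_pM2l.
- move=> x /=; have TZ : T (A x - z^-1 *: x) = x - z^-1 *: T x.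
    have TB' : T (A x - z^-1 *: x) = T (A x) - T (z^-1 *: x) by exact: linearB.
    have TZ : T (z^-1 *: x) = z^-1 *: T x by exact: linearZ.
    by rewrite TB' TZ AT.
  have BB : B (x - z^-1 *: T x) = B x - z^-1 *: B (T x).
    have -> : B (x - z^-1 *: T x) = B x - B (z^-1 *: T x) by exact: (linearB B').
    by congr (_ - _); exact: (linearZ_LR B').
  have e : B x - z^-1 *: (x + z *: B x) = - (z^-1 *: x).
    by rewrite scalerDr scalerA mulVf// scale1r opprD addrCA subrr addr0.
  by rewrite TZ BB BT e scalerN scalerA mulNr mulfV// scaleN1r opprK.
- move=> x /=; have AZ : A (- z *: B (T x)) = - z *: A (B (T x)) by exact: linearZ.
  rewrite AZ scalerA mulrN mulVf// scaleN1r opprK BT.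
  have AD : A (x + z *: B x) = A x + A (z *: B x) by exact: linearD.
  have ABz : A (z *: B x) = z *: A (B x) by exact: linearZ.
  have ABx : A (x + z *: B x) = B x by rewrite -TB TA.
  by rewrite ABx scaleNr [LHS]addrC addrK.
Qed.

Lemma invertible_neq0 (T A : {linear H -> H}) z : continuous A -> cancel T A -> cancel A T ->
  spectrum T z -> z != 0.
Proof.
move=> Ac TA AT zT; apply/eqP => z0; apply: zT; rewrite z0; exists A.
by split=> // [|x|x]; [exact: linearP|rewrite scale0r subr0 TA|rewrite scale0r subr0 AT].
Qed.

Lemma spectrum_inverse (T A : {linear H -> H}) z : continuous T -> continuous A ->
  cancel T A -> cancel A T -> spectrum T z -> spectrum A z^-1.
Proof.
move=> Tc Ac TA AT zT; have z0 := invertible_neq0 Ac TA AT zT.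
move=> Ainv; apply: zT; rewrite -[z]invrK.
by apply: shifted_inverse Ac AT TA _ Ainv; rewrite invr_eq0.
Qed.

(** The conventions for degenerate infima and suprema are consistent here: for
    empty sets both sides are 0, and if inf E = 0 then F is unbounded, so sup F
    and its inverse are 0. *)
Lemma inf_sup_inv (E F : set R) : (forall r : R, E r -> 0 < r) -> (forall r : R, F r -> 0 < r) ->
  (forall r : R, E r -> F r^-1) -> (forall r : R, F r -> E r^-1) -> inf E = (sup F)^-1.
Proof.
move=> E0 F0 EF FE.
have [E_0|/set0P[a Ea]] := eqVneq E set0.
  have -> : F = set0 by apply/seteqP; split=> // x /FE; rewrite E_0.
  by rewrite E_0 sup0 inf0 invr0.
have Elb : has_lbound E by exists 0 => x /E0/ltW.
have Fne : F !=set0 by exists a^-1; exact: EF.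
have i0 : 0 <= inf E by apply: lb_le_inf; [exists a|move=> x /E0/ltW].
have [i_0|i_n0] := eqVneq (inf E) 0.
  rewrite i_0 sup_out ?invr0// => -[_ [M MF]].
  have M0 : 0 < M by apply: lt_le_trans (MF _ (EF _ Ea)); rewrite invr_gt0 E0.
  suff : M^-1 <= inf E by rewrite i_0 leNgt invr_gt0 M0.
  apply: lb_le_inf; first by exists a.
  move=> x Ex; rewrite invf_ple ?posrE//; [exact/MF/EF|exact: E0].
have ip : 0 < inf E by rewrite lt_neqAle eq_sym i_n0.
have Fub : ubound F (inf E)^-1.
  by move=> x Fx; rewrite -[x]invrK lef_pV2 ?posrE ?invr_gt0 ?(F0 _ Fx)//; apply: ge_inf => //; exact: FE.
have sp : 0 < sup F.
  by apply: lt_le_trans (F0 _ (EF _ Ea)) _; apply: ub_le_sup; [exists (inf E)^-1|exact: EF].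
apply/eqP; rewrite eq_le; apply/andP; split.
  rewrite -[inf E]invrK lef_pV2 ?posrE ?invr_gt0//; exact: ge_sup.
apply: lb_le_inf; first by exists a.
move=> x Ex; rewrite -[x]invrK lef_pV2 ?posrE ?invr_gt0 ?(E0 _ Ex)//.
by apply: ub_le_sup; [exists (inf E)^-1|exact: EF].
Qed.

Lemma spectral_min_inverse (T A : {linear H -> H}) : continuous T -> continuous A ->
  cancel T A -> cancel A T -> spectral_min T = (spectral_radius A)^-1.
Proof.
move=> Tc Ac TA AT; apply: inf_sup_inv.
- by move=> _ [z /(invertible_neq0 Ac TA AT) z0 <-]; rewrite modulus_gt0.
- by move=> _ [z /(invertible_neq0 Tc AT TA) z0 <-]; rewrite modulus_gt0.
- move=> _ [z /(spectrum_inverse Tc Ac TA AT) zA <-].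
  by exists z^-1 => //; rewrite modulusV.
- move=> _ [z /(spectrum_inverse Ac Tc AT TA) zA <-].
  by exists z^-1 => //; rewrite modulusV.
Qed.

End Spectrum.

(** * Rotational symmetry *)

Section Rotation.
Variables (R : realType) (H : completeNormedModType R[i]) (dot : {dot H for Num.conj}).
Hypothesis hdot : induces_norm dot.
Variable e : int -> H.
Hypothesis he : orthonormal_basis dot e.

Lemma modulus_expz (a : R[i]) (n : int) : modulus a = 1 -> modulus (a ^ n) = 1.
Proof.
move=> a1; case: n => n; first by rewrite -exprnP modulusX a1 expr1n.
by rewrite NegzE -exprnN modulusV modulusX a1 expr1n invr1.
Qed.

(** Finite linear combinations as lists of index-coefficient pairs. Repeated
    indices are allowed, so that sums of combinations are concatenations. *)
Definition formal_sum (l : seq (int * R[i])) : H := \sum_(p <- l) p.2 *: e p.1.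

Section Multiplier.
Variable m : int -> R[i].
Hypothesis m1 : forall n, modulus (m n) = 1.

Definition twist (l : seq (int * R[i])) := [seq (p.1, p.2 * m p.1) | p <- l].

Definition scale_sum (a : R[i]) (l : seq (int * R[i])) := [seq (p.1, a * p.2) | p <- l].

Lemma formal_sum_cat l l' : formal_sum (l ++ l') = formal_sum l + formal_sum l'.
Proof. exact: big_cat. Qed.

Lemma formal_sum_scale a l : formal_sum (scale_sum a l) = a *: formal_sum l.
Proof.
rewrite /formal_sum big_map scaler_sumr; apply: eq_bigr => p _.
by rewrite scalerA.
Qed.

Lemma twist_scale a l : twist (scale_sum a l) = scale_sum a (twist l).
Proof. by rewrite /twist /scale_sum -!map_comp; apply: eq_map => p /=; rewrite mulrA. Qed.

Lemma twist_cat l l' : twist (l ++ l') = twist l ++ twist l'.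
Proof. exact: map_cat. Qed.

(** In the double sum for the squared norm only pairs with equal indices
    survive, and there m contributes |m n| ^ 2 = 1. *)
Lemma nm_twist l : nm (formal_sum (twist l)) = nm (formal_sum l).
Proof.
have dotE (l1 : seq (int * R[i])) : dot (formal_sum l1) (formal_sum l1) =
    \sum_(p <- l1) \sum_(q <- l1) p.2 * (Num.conj q.2 * (p.1 == q.1)%:R).
  rewrite /formal_sum linear_sumlz; apply: eq_bigr => p _.
  rewrite linear_sumr; apply: eq_bigr => q _.
  by rewrite linearZlr /= he.1.
have : nm (formal_sum (twist l)) ^+ 2 = nm (formal_sum l) ^+ 2.
  apply: complexI; rewrite !rmorphXn /= -!nmE !hdot !dotE big_map.
  apply: eq_bigr => p _; rewrite big_map; apply: eq_bigr => q _ /=.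
  have [pq|_] := eqVneq p.1 q.1; last by rewrite !mulr0.
  rewrite !mulr1 pq rmorphM mulrACA -[X in _ * X = _]normCK modulusE m1.
  by rewrite expr1n mulr1.
by move=> /eqP; rewrite eqrXn2 ?nm_ge0// => /eqP.
Qed.

Lemma formal_sum_dense x (eps : R) : 0 < eps -> exists l, nm (formal_sum l - x) < eps.
Proof.
move=> /(finite_sums_dense he x)[s [c [_ sc]]]; exists [seq (i, c i) | i <- s].
by rewrite /formal_sum big_map.
Qed.

(** The closure of the graph of formal_sum l |-> formal_sum (twist l). That it is
    the graph of a linear isometry follows from nm_twist, without checking that
    the map on finite sums is well defined. *)
Definition twist_graph (x z : H) := forall eps : R, 0 < eps ->
  exists l, nm (formal_sum l - x) < eps /\ nm (formal_sum (twist l) - z) < eps.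

Lemma twist_graph_nm x z : twist_graph x z -> nm z = nm x.
Proof.
move=> G; apply/eqP; rewrite eq_le; apply/andP; split; apply/ler_addgt0Pr => eps eps0.
  have [l [l1 l2]] := G (eps / 2) ltac:(by rewrite divr_gt0).
  have := nmtri z (formal_sum (twist l)) 0; have := nmtri (formal_sum l) x 0.
  by rewrite !subr0 nm_twist (nmC z); lra.
have [l [l1 l2]] := G (eps / 2) ltac:(by rewrite divr_gt0).
have := nmtri x (formal_sum l) 0; have := nmtri (formal_sum (twist l)) z 0.
by rewrite !subr0 nm_twist (nmC x); lra.
Qed.

Lemma twist_graph_linear a x z x' z' : twist_graph x z -> twist_graph x' z' ->
  twist_graph (a *: x + x') (a *: z + z').
Proof.
move=> G G' eps eps0.
have a0 := modulus_ge0 a.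
have e0 : 0 < eps / (modulus a + 1) by rewrite divr_gt0//; lra.
have [l [l1 l2]] := G _ e0; have [l' [l'1 l'2]] := G' _ e0.
exists (scale_sum a l ++ l'); rewrite twist_cat twist_scale !formal_sum_cat !formal_sum_scale.
have key (u v u' v' : H) : nm (u - v) < eps / (modulus a + 1) -> nm (u' - v') < eps / (modulus a + 1) ->
    nm (a *: u + u' - (a *: v + v')) < eps.
  move=> h h'; rewrite opprD addrACA -scalerBr; apply: le_lt_trans (nmD _ _) _.
  rewrite nmZ; have -> : eps = modulus a * (eps / (modulus a + 1)) + eps / (modulus a + 1).
    by field; lra.
  by apply: ler_ltD => //; rewrite ler_wpM2l// ltW.
by split; apply: key.
Qed.

Lemma twist_graph_total x : exists z, twist_graph x z.
Proof.
have /choice[l lP] : forall n : nat, exists l, nm (formal_sum l - x) < n.+1%:R^-1.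
  by move=> n; apply: formal_sum_dense; rewrite invr_gt0 ltr0n.
have diff k j : nm (formal_sum (twist (l k)) - formal_sum (twist (l j))) =
    nm (formal_sum (l k) - formal_sum (l j)).
  have sub l1 l2 : formal_sum l1 - formal_sum l2 = formal_sum (l1 ++ scale_sum (-1) l2).
    by rewrite formal_sum_cat formal_sum_scale scaleN1r.
  by rewrite !sub -twist_scale -twist_cat nm_twist.
have [|z zP] := @cauchy_nm R H (fun n => formal_sum (twist (l n))).
  move=> eps eps0; have [n0 n0P] := harmonic_small 2 eps0.
  exists n0 => k j kn jn; rewrite diff.
  have hk := lt_le_trans (lP k) (harmonic_le R kn).
  have hj := lt_le_trans (lP j) (harmonic_le R jn).
  have := n0P n0 (leqnn _); rewrite nmC in hj.
  move: (n0.+1%:R^-1) hk hj => v hk hj v2.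
  apply: le_lt_trans (nmtri _ x _) _; lra.
exists z => eps eps0; have [n0 n0P] := (cvgn_nmP _ _).1 zP _ eps0.
have [n1 n1P] := harmonic_small 1 eps0.
exists (l (maxn n0 n1)); split; last by apply: n0P; exact: leq_maxl.
apply: lt_trans (lP _) _; have := n1P (maxn n0 n1) (leq_maxr _ _).
by rewrite mul1r.
Qed.

Lemma twist_graph_unique x z z' : twist_graph x z -> twist_graph x z' -> z = z'.
Proof.
move=> G G'; have := twist_graph_linear (-1) G G'; rewrite !scaleN1r addNr => /twist_graph_nm.
by rewrite nm0 => /nm0_eq0/eqP; rewrite addrC subr_eq0 => /eqP.
Qed.

Lemma diagonal_operator : exists J : H -> H,
  [/\ linear J, forall x, nm (J x) = nm x & forall n, J (e n) = m n *: e n].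
Proof.
have [J JP] := choice twist_graph_total; exists J; split.
- by move=> a x y; apply: twist_graph_unique (JP _) _; exact: twist_graph_linear.
- by move=> x; exact: twist_graph_nm.
- move=> n; apply: twist_graph_unique (JP _) _ => eps eps0; exists [:: (n, 1)].
  by rewrite /formal_sum /= !big_seq1 /= mul1r scale1r !subrr nm0.
Qed.

End Multiplier.

Lemma isometry_continuous (J : H -> H) : linear J -> (forall x, nm (J x) = nm x) -> continuous J.
Proof. by move=> Jl Jn; apply/(linear_nmP Jl); exists 1 => // x; rewrite Jn mul1r. Qed.

(** J is diagonal with entries th ^ n; since S raises the index by one, J S and
    th S J agree on the basis. *)
Lemma rotation_operator (w : int -> R) (S : {linear H -> H}) (th : R[i]) :
  continuous S -> (forall n, S (e n) = (w n)%:C *: e (n + 1)) -> modulus th = 1 ->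
  exists J J' : {linear H -> H}, [/\ forall x, nm (J x) = nm x, cancel J' J,
     forall x, nm (J' x) = nm x & forall x, J (S x) = th *: S (J x)].
Proof.
move=> Sc SS th1; have th0 : th != 0 by rewrite -modulus_gt0 th1.
have [J [Jl Jn Je]] := @diagonal_operator (fun n => th ^ n) (fun n => modulus_expz n th1).
have thV1 : modulus th^-1 = 1 by rewrite modulusV th1 invr1.
have [J' [J'l J'n J'e]] := @diagonal_operator (fun n => th^-1 ^ n) (fun n => modulus_expz n thV1).
have Jc := isometry_continuous Jl Jn; have J'c := isometry_continuous J'l J'n.
pose JL : {linear H -> H} := HB.pack J (GRing.isLinear.Build _ _ _ _ J Jl).
pose JL' : {linear H -> H} := HB.pack J' (GRing.isLinear.Build _ _ _ _ J' J'l).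
exists JL, JL'; split=> //.
- apply: (eq_continuous_linear he (A := fun x => J (J' x)) (B := id)).
  + by move=> a x y; rewrite J'l Jl.
  + by move=> a x y.
  + by move=> x; apply: continuous_comp; [exact: J'c|exact: Jc].
  + by move=> x; exact: cvg_id.
  + move=> i; rewrite J'e -[J _]/(JL _) linearZ /= -[X in _ *: X]/(J _) Je scalerA.
    by rewrite -exprzMl ?unitfE ?invr_eq0// mulVf// exp1rz scale1r.
- apply: (eq_continuous_linear he (A := fun x => J (S x)) (B := fun x => th *: S (J x))).
  + by move=> a x y; rewrite linearP Jl.
  + by move=> a x y; rewrite Jl linearP scalerDr !scalerA mulrC.
  + by move=> x; apply: continuous_comp; [exact: Sc|exact: Jc].
  + have Bl : linear (fun x => th *: S (J x)).
      by move=> a x y; rewrite Jl linearP scalerDr !scalerA mulrC.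
    have [M M0 SM] := (linear_nmP (@linearP _ _ _ _ S)).1 Sc.
    by apply/(linear_nmP Bl); exists M => // x; rewrite nmZ th1 mul1r -(Jn x).
  + move=> i.
    have JZ : J ((w i)%:C *: e (i + 1)) = (w i)%:C *: J (e (i + 1)) by exact: (linearZ_LR JL).
    have SZ : S (th ^ i *: e i) = th ^ i *: S (e i) by exact: linearZ.
    rewrite SS JZ !Je SZ SS !scalerA exprzDr ?unitfE// expr1z.
    by congr (_ *: _); ring.
Qed.

Lemma has_deriv_rotate (f : R[i] -> H) th z d : modulus th = 1 -> has_deriv f (th * z) d ->
  has_deriv (fun w => f (th * w)) z (th *: d).
Proof.
move=> th1 fd eps eps0; have [dl dl0 dlP] := fd eps eps0.
exists dl => // h hdl; have := dlP (th * h); rewrite modulusM th1 mul1r => /(_ hdl).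
by rewrite mulrDr scalerA (mulrC h).
Qed.

(** The map f |-> tl f, (tl f) z = J (f (th z)), satisfies
    (S - z) (tl f) z = th^-1 J ((S - th z) f (th z)), so it carries T_U for U
    near th z0 to T_U for th^-1 U near z0, and J is invertible and isometric. *)
Lemma bishop_beta_at_rotate (S : {linear H -> H}) (J J' : {linear H -> H}) th z0 :
  continuous S -> modulus th = 1 ->
  (forall x, nm (J x) = nm x) -> cancel J' J -> (forall x, nm (J' x) = nm x) ->
  (forall x, J (S x) = th *: S (J x)) ->
  bishop_beta_at S z0 -> bishop_beta_at S (th * z0).
Proof.
move=> Sc th1 Jn JK J'n JS [V [Vo Vz VP]].
have th0 : th != 0 by rewrite -modulus_gt0 th1.
have Jc : continuous J by apply: isometry_continuous => //; exact: linearP.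
have J'c : continuous J' by apply: isometry_continuous => //; exact: linearP.
have rot_open U : open (U : set R[i]^o) -> open ([set z | U (th * z)] : set R[i]^o).
  move=> /open_modP Uo; apply/open_modP => z /Uo[d d0 dP]; exists d => // y yz.
  by apply: dP; rewrite -mulrBr modulusM th1 mul1r.
have rotV_open U : open (U : set R[i]^o) -> open ([set z | U (th^-1 * z)] : set R[i]^o).
  move=> /open_modP Uo; apply/open_modP => z /Uo[d d0 dP]; exists d => // y yz.
  by apply: dP; rewrite -mulrBr modulusM modulusV th1 invr1 mul1r.
have thK z : th * (th^-1 * z) = z by rewrite mulrA mulfV// mul1r.
have thVK z : th^-1 * (th * z) = z by rewrite mulrA mulVf// mul1r.
pose tl (f : R[i]^o -> H) : R[i]^o -> H := fun z => J (f (th * z)).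
have TUtl f z : J (TU S f (th * z)) = th *: TU S (tl f) z.
  have JB : J (TU S f (th * z)) = J (S (f (th * z))) - J ((th * z) *: f (th * z)) by exact: linearB.
  have JZ : J ((th * z) *: f (th * z)) = (th * z) *: J (f (th * z)) by exact: linearZ.
  by rewrite JB JZ JS /TU /tl scalerBr scalerA.
have J0 x : J x = 0 -> x = 0 by move=> x0; apply: nm0_eq0; rewrite -Jn x0 nm0.
have tl_an (U : set R[i]^o) f : analytic_on U f -> analytic_on ([set z | U (th * z)] : set R[i]^o) (tl f).
  move=> /analyticP fa; apply/analyticP => z /fa[d dP]; exists (J (th *: d)).
  by apply: (has_deriv_linear Jc (f := fun w => f (th * w))); exact: has_deriv_rotate.
exists [set z | V (th^-1 * z)]; split; [exact: rotV_open|by rewrite /= thVK|].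
move=> U Uo UV; pose U' : set R[i]^o := [set z | U (th * z)].
have U'V : U' `<=` V by move=> z /UV; rewrite /= thVK.
have [/injective_TUP inj /(closed_range_TUP Sc) cl] := VP U' (rot_open U Uo) U'V.
split.
  apply/injective_TUP => f fa f0 z Uz; apply: J0.
  have := inj (tl f) (tl_an _ _ fa) _ (th^-1 * z); rewrite /tl thK; apply.
    move=> y Uy; have := TUtl f y; rewrite f0// linear0 => /esym/eqP.
    by rewrite scaler_eq0 (negbTE th0) => /eqP.
  by rewrite /U' /= thK.
apply/(closed_range_TUP Sc) => g ga gap.
pose g' : R[i]^o -> H := fun z => th^-1 *: tl g z.
(* solve the rotated equation on U', then rotate the solution h back *)
have [||h ha hP] := cl g'.
- apply/analyticP => z Uz; have [d dP] := (analyticP _ _).1 (tl_an _ _ ga) z Uz.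
  exists (th^-1 *: d) => eps /dP[dl dl0 dlP]; exists dl => // k /dlP.
  rewrite /g' scalerA (mulrC k) -scalerA -!scalerBr nmZ.
  by rewrite modulusV th1 invr1 mul1r.
- move=> K KU Kc eps eps0.
  have [||f fa fP] := gap [set th * z | z in K] _ _ eps eps0.
  + by move=> _ [z /KU Uz <-].
  + apply: continuous_compact => //; apply: continuous_subspaceT => z.
    apply/(continuous_nmP (V := R[i]^o) (W := R[i]^o)) => ep ep0; exists ep => // y.
    by rewrite !nmoE -mulrBr modulusM th1 mul1r.
  exists (tl f); first exact: tl_an.
  move=> z Kz; have := fP (th * z) ltac:(by exists z).
  rewrite -Jn; have -> : J (TU S f (th * z) - g (th * z)) = J (TU S f (th * z)) - J (g (th * z)) by exact: linearB.
  rewrite TUtl -[J (g _)]/(tl g z) => h.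
  have -> : TU S (tl f) z - g' z = th^-1 *: (th *: TU S (tl f) z - tl g z).
    by rewrite scalerBr scalerA mulVf// scale1r.
  by rewrite nmZ modulusV th1 invr1 mul1r.
exists (fun z => J' (h (th^-1 * z))).
  have thV1 : modulus th^-1 = 1 by rewrite modulusV th1 invr1.
  apply/analyticP => z Uz.
  have [d dP] := (analyticP _ _).1 ha (th^-1 * z) ltac:(by rewrite /U' /= thK).
  exists (J' (th^-1 *: d)).
  by apply: (has_deriv_linear J'c (f := fun w => h (th^-1 * w))); exact: has_deriv_rotate.
move=> z Uz; set f := fun z => _.
have tlf : tl f = h by apply/funext => y; rewrite /tl /f thVK JK.
have := TUtl f (th^-1 * z); rewrite thK tlf hP; last by rewrite /U' /= thK.
rewrite /g' scalerA mulfV// scale1r /tl thK => e1.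
apply/eqP; rewrite -subr_eq0; apply/eqP/J0.
have -> : J (TU S f z - g z) = J (TU S f z) - J (g z) by exact: linearB.
by rewrite e1 subrr.
Qed.

End Rotation.

(** * The theorem *)

Section Circles.
Variables (R : realType) (H : completeNormedModType R[i]).
Variable S : {linear H -> H}.
Hypothesis S_cont : continuous S.
Hypothesis rotate : forall z z', modulus z = modulus z' -> bishop_beta_at S z -> bishop_beta_at S z'.

(** By symmetry a circle about 0 is contained in sigma_beta or disjoint from it. *)
Lemma circle_sub_sigma_beta z : sigma_beta S z -> circle (modulus z) `<=` sigma_beta S.
Proof. by move=> zS z' z'z; apply: contra_not zS; exact: rotate. Qed.

Lemma sigma_beta_one_circle t : sigma_beta S `<=` circle t ->
  bishop_beta S \/ sigma_beta S = circle t.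
Proof.
move=> St; have [[z zS]|nS] := pselect (exists z, sigma_beta S z); [right|left].
  apply/seteqP; split=> //; have <- : modulus z = t := St z zS.
  exact: circle_sub_sigma_beta.
by apply: bishop_betaP => // z; apply: contrapT => zS; apply: nS; exists z.
Qed.

Lemma sigma_beta_two_circles t t' : sigma_beta S `<=` circle t `|` circle t' ->
  [\/ bishop_beta S, sigma_beta S = circle t, sigma_beta S = circle t' |
      sigma_beta S = circle t `|` circle t'].
Proof.
move=> St; have [[z zS zt]|nt] := pselect (exists2 z, sigma_beta S z & modulus z = t); last first.
  have [|b|e] := @sigma_beta_one_circle t'; [|exact: Or41|exact: Or43].
  by move=> z zS; have [zt|//] := St z zS; case: nt; exists z.
have tS : circle t `<=` sigma_beta S by rewrite -zt; exact: circle_sub_sigma_beta.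
have [[z' z'S z't']|nt'] := pselect (exists2 z, sigma_beta S z & modulus z = t').
  apply: Or44; apply/seteqP; split=> //; rewrite subUset; split=> //.
  by rewrite -z't'; exact: circle_sub_sigma_beta.
apply: Or42; apply/seteqP; split=> // y yS.
by have [//|yt'] := St y yS; case: nt'; exists y.
Qed.

End Circles.

Theorem theorem4p13 (R : realType) (H : completeNormedModType R[i])
    (dot : {dot H for Num.conj}) (hdot : induces_norm dot)
    (e : int -> H) (he : orthonormal_basis dot e)
    (w : int -> R) (w_gt0 : forall n, 0 < w n) (w_bnd : bounded_fun w)
    (S : {linear H -> H}) (S_cont : continuous S)
    (S_shift : forall n, S (e n) = (w n)%:C *: e (n + 1))
    (hminus : [/\ spectral_min S = r1minus w, r1minus w = r2minus w,
                  r2minus w = r3minus w & r3minus w = rminus w])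
    (hplus : [/\ r1plus w = r2plus w, r2plus w = r3plus w,
                 r3plus w = rplus w & rplus w = spectral_radius S]) :
  (~ invertible S ->
     bishop_beta S \/ sigma_beta S = circle (spectral_radius S)) /\
  (forall Sinv : H -> H, is_inverse S Sinv ->
     [\/ bishop_beta S,
         sigma_beta S = circle (spectral_radius Sinv)^-1,
         sigma_beta S = circle (spectral_radius S) |
         sigma_beta S = circle (spectral_radius Sinv)^-1
                          `|` circle (spectral_radius S)]).
Proof.
have qE : spectral_min S = rminus w by case: hminus => -> -> -> ->.
have rE : r1plus w = spectral_radius S by case: hplus => -> -> -> ->.
set q := spectral_min S in qE *; set r := spectral_radius S in rE *.
have annulus r1 r2 : 0 <= r1 -> 0 <= r2 -> q < r1 -> r2 < r ->
    exists2 c, 0 < c & forall l : R[i], r1 <= modulus l <= r2 -> bounded_below_by S c l.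
  move=> r10 r20; rewrite qE -rE => /(rminus_lt w_gt0 w_bnd r10)[n1 P1].
  move=> /(r1plus_gt w_gt0 r20)[n2 P2].
  have [d dr1 dP] := P1 (maxn n1 n2) (leq_maxl _ _).
  have [k r2k kP] := P2 (maxn n1 n2) (leq_maxr _ _).
  exact: (shift_bounded_below hdot he w_gt0 S_cont S_shift kP dP).
have off z : modulus z <> q -> modulus z <> r -> bounded_below_at S z.
  move=> zq zr; have [zq'|zq'|//] := ltgtP (modulus z) q.
    exact: bounded_below_lt_min.
  have [zr'|zr'|//] := ltgtP (modulus z) r; last exact: bounded_below_gt_radius.
  have [c c0 cP] := annulus _ _ (modulus_ge0 z) (modulus_ge0 z) zq' zr'.
  by exists c => //; apply: cP; rewrite lexx.
have near_mod (z : R[i]) (t : R) : modulus z <> t -> exists2 d : R, 0 < d &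
    forall y, modulus (y - z) < d -> modulus y <> t.
  move=> /eqP zt; exists `|modulus z - t|; first by rewrite normr_gt0 subr_eq0.
  move=> y yz yt; move: yz; rewrite ltNge => /negP; apply; rewrite -yt ler_norml.
  have := modulusD (y - z) z; have := modulusD (z - y) y.
  by rewrite !subrK (modulusB z); move=> *; apply/andP; split; lra.
(* off the two circles S - z is locally bounded below *)
have sub2 : sigma_beta S `<=` circle q `|` circle r.
  move=> z zS; apply: contrapT => /not_orP[zq zr]; apply: zS; apply: (@bounded_below_around_beta _ _ S S_cont
    [set y | modulus y <> q /\ modulus y <> r]) => //.
    apply/open_modP => y [/near_mod[d1 d10 D1] /near_mod[d2 d20 D2]].
    exists (Num.min d1 d2); first by rewrite lt_min d10.
    by move=> x; rewrite lt_min => /andP[/D1 ? /D2 ?].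
  by move=> y [yq yr]; exact/bounded_below_around_at/off.
have rotate z z' : modulus z = modulus z' -> bishop_beta_at S z -> bishop_beta_at S z'.
  move=> zz'; have [z0|z0] := eqVneq z 0.
    by rewrite (_ : z' = z)// z0; apply: modulus0_eq0; rewrite -zz' z0 modulus0.
  have mz : modulus z != 0 by rewrite gt_eqF// modulus_gt0.
  have th1 : modulus (z' / z) = 1 by rewrite modulusM modulusV -zz' mulfV.
  have [J [J' [Jn JK J'n JS]]] := rotation_operator hdot he S_cont S_shift th1.
  by move=> /(bishop_beta_at_rotate S_cont th1 Jn JK J'n JS); rewrite divfK.
split=> [Sni|Sinv [Sinvl Sinvc SK KS]]; last first.
  pose A : {linear H -> H} := HB.pack Sinv (GRing.isLinear.Build _ _ _ _ Sinv Sinvl).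
  rewrite -(spectral_min_inverse (T := S) (A := A))//.
  exact: sigma_beta_two_circles.
apply: sigma_beta_one_circle => // z zS.
have S0 : spectrum S 0.
  by move=> [A [Al Ac AK KA]]; apply: Sni; exists A; split=> // x;
    [have := AK x|have := KA x]; rewrite scale0r subr0.
have q0 : q = 0.
  apply/eqP; rewrite eq_le; apply/andP; split.
    rewrite -(modulus0 R); apply: ge_inf; last by exists 0.
    by exists 0 => _ [l _ <-]; exact: modulus_ge0.
  by apply: lb_le_inf; [exists (modulus (0 : R[i])), 0|move=> _ [l _ <-]; exact: modulus_ge0].
have [M MP] := spectrum_bounded S_cont.
have r0 : 0 <= r.
  by rewrite -(modulus0 R); apply: ub_le_sup; [exists M => _ [l /MP ? <-]|exists 0].
(* if q = 0 < r, then 0 is surrounded by annuli on which S - z is bounded below *)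
have [zq|//] := sub2 z zS.
have z0 : z = 0 by apply: modulus0_eq0; rewrite -q0.
rewrite z0 /circle /= modulus0; apply/eqP; rewrite eq_le r0 /= leNgt; apply/negP => rp.
apply: zS; rewrite z0.
apply: (@bounded_below_around_beta _ _ S S_cont [set y | modulus y < r]); last by rewrite /= modulus0.
  apply/open_modP => y yr; exists (r - modulus y); first by rewrite subr_gt0.
  by move=> x xy; have := modulusD (x - y) y; rewrite subrK /=; lra.
move=> y yr; have [y0|y0] := eqVneq y 0; last first.
  apply/bounded_below_around_at/off; last by move=> yr'; move: yr; rewrite /= yr' ltxx.
  by rewrite q0 => /modulus0_eq0/eqP; rewrite (negbTE y0).
exists (r / 6); first by rewrite divr_gt0.
move=> s /andP[s0 sr].
have [c c0 cP] := annulus s (6 * s) (ltW s0) ltac:(lra) ltac:(lra) ltac:(lra).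
by exists c => // l; rewrite y0 subr0; exact: cP.
Qed.
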